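(* For every fixed $\varepsilon>0$ there is a polynomial-time algorithm that, given a finite set $P\subset\mathbb{R}^2$, computes a point burning sequence for $P$ whose length (number of steps until all points of $P$ are burnt) is at most $(2+\varepsilon)\,b_p(P)$, where $b_p(P)$ is the point burning number of $P$.
   Context: Let $P\subset\mathbb{R}^2$ be a finite set of $n$ points and let $D(c,r)$ denote the closed Euclidean disk of center $c$ and radius $r$. The point burning process on $P$: at step $1$ one point $s_1\in P$ is chosen as a burning source and becomes burnt. At each subsequent step $i$, every point of the plane within distance $1$ of a currently burnt point becomes burnt, and in addition one new currently unburnt point $s_i\in P$ may be chosen as a burning source (at the last step there may be no new source). Thus after step $T$ the burnt region is $\bigcup_{i} D(s_i,T-i)$, where $s_i$ is the source chosen at step $i$. A point burning sequence of length $T$ is a choice of sources such that all points of $P$ are burnt after step $T$. The point burning number $b_p(P)$ is the minimum length of such a sequence. *)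

(* Defs.v *)
From Stdlib Require Import Reals ZArith List Arith.
Import ListNotations.
Open Scope R_scope.

Definition pt := (R * R)%type.

Definition dist (p q : pt) : R :=
  sqrt ((fst p - fst q) ^ 2 + (snd p - snd q) ^ 2).

(** A (candidate) burning schedule is a list [s] of length [T] (the number of
    steps); entry [i] (0-indexed) is the source chosen at step [i+1], or [None]
    if no new source is chosen at that step. *)
Definition sched := list (option pt).

(** [q] is burnt at (after the spreading of) step [i+1] by the sources chosen
    at earlier steps [j+1 < i+1]: source [j+1] has burnt D(s_{j+1}, i - j). *)
Definition burnt_before (s : sched) (i : nat) (q : pt) : Prop :=
  exists j c, (j < i)%nat /\ nth j s None = Some c /\ dist c q <= INR (i - j).

Definition point_burning_seq (P : list pt) (s : sched) : Prop :=
  (1 <= length s)%nat /\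
  (exists c, nth 0 s None = Some c) /\
  (forall i, (i + 1 < length s)%nat -> nth i s None <> None) /\
  (forall i c, nth i s None = Some c -> In c P /\ ~ burnt_before s i c) /\
  (* after step T = length s every point of P is burnt:
     P is covered by the union of D(s_{j+1}, T - (j+1)) *)
  (forall p, In p P ->
     exists j c, nth j s None = Some c /\ dist c p <= INR (length s - 1 - j)).

Definition point_burning_number (P : list pt) (b : nat) : Prop :=
  (exists s, point_burning_seq P s /\ length s = b) /\
  (forall s, point_burning_seq P s -> (b <= length s)%nat).

(** * A real-RAM model of computation (unit cost)

    Real memory cells x_0, x_1, ... (values in R), natural-number registers
    a_0, a_1, ... (values in nat).  Arithmetic +, -, *, / (division by 0
    gives whatever Rdiv gives; irrelevant), integer constants, comparisons,
    conversion nat -> real, indirect addressing of real cells through nat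
    registers, and an output tape of (optional) point indices.  No floor
    function and no bit operations. *)
Inductive instr : Type :=
| RConst (i : nat) (c : Z)
| RAdd (i j k : nat)
| RSub (i j k : nat)
| RMul (i j k : nat)
| RDiv (i j k : nat)
| RFromNat (i a : nat)
| RLoadInd (i a : nat)
| RStoreInd (a i : nat)
| NConst (a m : nat)
| NInc (a : nat)
| NDec (a : nat)                    (* a_a := a_a - 1 (truncated) *)
| NCopy (a b : nat)
| JLeR (i j t : nat)
| JLeN (a b t : nat)
| Jmp (t : nat)
| OutSome (a : nat)
| OutNone
| Halt.

Definition program := list instr.

Record config : Type := Config {
  pc : nat;
  xm : nat -> R;
  nm : nat -> nat;
  outrev : list (option nat)
}.

Definition updR (f : nat -> R) (i : nat) (v : R) : nat -> R :=
  fun k => if Nat.eqb k i then v else f k.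
Definition updN (f : nat -> nat) (i : nat) (v : nat) : nat -> nat :=
  fun k => if Nat.eqb k i then v else f k.

Definition exec (ins : instr) (c : config) : config :=
  let '(Config p x a o) := c in
  let nx := S p in
  match ins with
  | RConst i z => Config nx (updR x i (IZR z)) a o
  | RAdd i j k => Config nx (updR x i (x j + x k)) a o
  | RSub i j k => Config nx (updR x i (x j - x k)) a o
  | RMul i j k => Config nx (updR x i (x j * x k)) a o
  | RDiv i j k => Config nx (updR x i (x j / x k)) a o
  | RFromNat i b => Config nx (updR x i (INR (a b))) a o
  | RLoadInd i b => Config nx (updR x i (x (a b))) a o
  | RStoreInd b i => Config nx (updR x (a b) (x i)) a o
  | NConst b m => Config nx x (updN a b m) o
  | NInc b => Config nx x (updN a b (S (a b))) o
  | NDec b => Config nx x (updN a b (pred (a b))) o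
  | NCopy b b' => Config nx x (updN a b (a b')) o
  | JLeR i j t => Config (if Rle_dec (x i) (x j) then t else nx) x a o
  | JLeN b b' t => Config (if Nat.leb (a b) (a b') then t else nx) x a o
  | Jmp t => Config t x a o
  | OutSome b => Config nx x a (Some (a b) :: o)
  | OutNone => Config nx x a (None :: o)
  | Halt => c
  end.

(** One step; [None] means the machine has halted (Halt instruction or
    program counter out of range). *)
Definition step (prog : program) (c : config) : option config :=
  match nth_error prog (pc c) with
  | None => None
  | Some Halt => None
  | Some ins => Some (exec ins c)
  end.

Fixpoint run (prog : program) (k : nat) (c : config) : config :=
  match k with
  | O => c
  | S k' => match step prog c with
            | None => c
            | Some c' => run prog k' c'
            end
  end.

Definition halts_within (prog : program) (t : nat) (c : config)
  (o : list (option nat)) : Prop :=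
  step prog (run prog t c) = None /\ rev (outrev (run prog t c)) = o.

(** Input encoding of P = [p_0; ...; p_{n-1}]: x_{2k} = fst p_k,
    x_{2k+1} = snd p_k, all other cells 0; a_0 = n, other registers 0. *)
Definition init_config (P : list pt) : config :=
  Config 0
    (fun k => match nth_error P (Nat.div2 k) with
              | Some p => if Nat.even k then fst p else snd p
              | None => 0
              end)
    (fun k => if Nat.eqb k 0 then length P else 0%nat)
    [].

Definition valid_output (P : list pt) (o : list (option nat)) : Prop :=
  forall k, In (Some k) o -> (k < length P)%nat.

Definition decode (P : list pt) (o : list (option nat)) : sched :=
  map (option_map (fun k => nth k P (0, 0))) o.

(* Main.v *)
(** If [P] burns in [b] steps, then [P] is covered by [b] disks of radius [b - 1]
    centred at points of [P].  Conversely, given a cover by [m] disks of radius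
    [r], always burning an unburnt centre (any unburnt point once all centres are
    burnt) has every centre burnt after [m] steps and all of [P] burnt [r] steps
    later.  So it suffices to find, for each guess [r + 1] of [b], a cover of
    size at most [1 + 1/q] times the optimum.

    To do so, take an uncovered point [v] and let [m_k] be the optimal number of
    disks for the uncovered points within distance [2 k r] of [v].  As [m_k] is
    at most quadratic in [k], some [k] bounded in terms of [q] satisfies
    [m_(k+1) <= (1 + 1/q) m_k]; there all the [m_k] are bounded and can be found by
    brute force.  Cover the larger ball optimally, remove it, and repeat.  The
    smaller balls of different rounds are more than [2 r] apart, so that no disk
    meets two of them and their optima add up to a lower bound. *)

(* Growing balls needs only comparisons of squared distances, so the method suits a machine with
   neither floor nor square root. The algorithm is written in a small language whose loops all run
   exactly [n] times: termination and a polynomial bound then hold for every program, and early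
   exits become flags. The brute force is a nest of loops of depth [M], where [M] depends on [q]
   alone.

   The guessed radius [r] runs through [0, ..., n - 1]. A guess is accepted when its cover has at
   most [(1 + 1/q) (r + 1)] disks. Rejection shows that no [r + 1] disks of radius [r] cover [P], so
   [b] is not [r + 1]; hence the first accepted guess has [r + 1 <= b]. The greedy schedule, with
   its last step of pure spreading, then has length at most [(1 + 1/q) (r + 1) + (r + 1)], which is
   at most [(2 + 1/q) b], and [q] is chosen with [1/q < eps]. *)
Require Import Defs.
From Stdlib Require Import Reals ZArith List Arith.
From Stdlib Require Import Lia Lra Bool Classical ClassicalDescription.
Import ListNotations.
Open Scope R_scope.

(** * A for-loop language over real arrays *)

Inductive idx : Type := IZero | IVar (a : nat).

Inductive expr : Type :=
| EConst (z : Z)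
| EVar (a : nat)
| EGet (A : nat) (i : idx)
| EAdd (e1 e2 : expr)
| ESub (e1 e2 : expr)
| EMul (e1 e2 : expr).

(* [IfLe e1 e2 c1 c2] branches on [e1 <= e2]; [For a c] runs [c] with the loop
   variable [a] ranging over [0, ..., n-1], where [n] is the number of points. *)
Inductive com : Type :=
| Skip
| Put (A : nat) (i : idx) (e : expr)
| Seq (c1 c2 : com)
| IfLe (e1 e2 : expr) (c1 c2 : com)
| For (a : nat) (c : com)
| Emit (a : nat)
| EmitNone.

(* [out] is the output tape in reverse order, as [outrev]. *)
Record store : Type := Store { arr : nat -> nat -> R; out : list (option nat) }.

Definition idx_val (env : nat -> nat) (i : idx) : nat :=
  match i with IZero => 0%nat | IVar a => env a end.

Fixpoint eval (env : nat -> nat) (m : nat -> nat -> R) (e : expr) : R :=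
  match e with
  | EConst z => IZR z
  | EVar a => INR (env a)
  | EGet A i => m A (idx_val env i)
  | EAdd e1 e2 => eval env m e1 + eval env m e2
  | ESub e1 e2 => eval env m e1 - eval env m e2
  | EMul e1 e2 => eval env m e1 * eval env m e2
  end.

Definition upd_arr (m : nat -> nat -> R) (A k : nat) (v : R) : nat -> nat -> R :=
  fun A' => if Nat.eqb A' A then updR (m A') k v else m A'.

Fixpoint loop (m : nat) (f : nat -> store -> store) (s : store) : store :=
  match m with
  | O => s
  | S m' => f m' (loop m' f s)
  end.

Fixpoint sem (n : nat) (c : com) (env : nat -> nat) (s : store) : store :=
  match c with
  | Skip => s
  | Put A i e => Store (upd_arr (arr s) A (idx_val env i) (eval env (arr s) e)) (out s)
  | Seq c1 c2 => sem n c2 env (sem n c1 env s)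
  | IfLe e1 e2 c1 c2 =>
      if Rle_dec (eval env (arr s) e1) (eval env (arr s) e2)
      then sem n c1 env s else sem n c2 env s
  | For a c => loop n (fun i s => sem n c (updN env a i) s) s
  | Emit a => Store (arr s) (Some (env a) :: out s)
  | EmitNone => Store (arr s) (None :: out s)
  end.

(** * Compilation to the real RAM *)

(* Array [A] at index [k] lives in the real cell [scratch + stride * k + A]; the
   cells below [scratch] are expression temporaries.  Registers 1 and 2 serve
   address computations, and loop variable [a] is register [6 + a]. *)
Notation stride := 24%nat.
Notation scratch := 16%nat.

(** Registers admit no addition, so [stride] is added in unary once per round while register 2
    counts up to the loop variable. Jump targets are absolute, hence the position [p] in all code
    generators. *)
Definition addr_code (p A : nat) (i : idx) : list instr :=
  match i with
  | IZero => [NConst 1 (scratch + A)]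
  | IVar a =>
      [NConst 1 (scratch + A); NConst 2 0; JLeN (6 + a) 2 (p + (5 + stride))]
        ++ repeat (NInc 1) stride ++ [NInc 2; Jmp (p + 2)]
  end.

(** A stack in the cells below [scratch]: the value goes to cell [t], the cells below [t] are kept,
    and [wf_expr] prevents the stack from reaching the arrays. *)
Fixpoint ecomp (t p : nat) (e : expr) : list instr :=
  match e with
  | EConst z => [RConst t z]
  | EVar a => [RFromNat t (6 + a)]
  | EGet A i => addr_code p A i ++ [RLoadInd t 1]
  | EAdd e1 e2 =>
      let c1 := ecomp t p e1 in
      c1 ++ ecomp (S t) (p + length c1) e2 ++ [RAdd t t (S t)]
  | ESub e1 e2 =>
      let c1 := ecomp t p e1 in
      c1 ++ ecomp (S t) (p + length c1) e2 ++ [RSub t t (S t)]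
  | EMul e1 e2 =>
      let c1 := ecomp t p e1 in
      c1 ++ ecomp (S t) (p + length c1) e2 ++ [RMul t t (S t)]
  end.

Fixpoint comp (p : nat) (c : com) : list instr :=
  match c with
  | Skip => []
  | Put A i e =>
      let c1 := ecomp 0 p e in
      c1 ++ addr_code (p + length c1) A i ++ [RStoreInd 1 0]
  | Seq c1 c2 => let l1 := comp p c1 in l1 ++ comp (p + length l1) c2
  | IfLe e1 e2 c1 c2 =>
      let l1 := ecomp 0 p e1 in
      let l2 := ecomp 1 (p + length l1) e2 in
      let p2 := (p + length l1 + length l2 + 1)%nat in
      let lf := comp p2 c2 in
      let pt := (p2 + length lf + 1)%nat in
      let lt := comp pt c1 in
      l1 ++ l2 ++ [JLeR 0 1 pt] ++ lf ++ [Jmp (pt + length lt)] ++ lt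
  | For a c =>
      let l := comp (p + 2) c in
      [NConst (6 + a) 0; JLeN 0 (6 + a) (p + 2 + length l + 2)]
        ++ l ++ [NInc (6 + a); Jmp (p + 1)]
  | Emit a => [OutSome (6 + a)]
  | EmitNone => [OutNone]
  end.

(* Well-formedness under [k] enclosing loops: a loop variable is named by its
   nesting depth, so that inner loops never overwrite outer variables. *)
Definition wf_idx (k : nat) (i : idx) : bool :=
  match i with IZero => true | IVar a => Nat.ltb a k end.

Fixpoint wf_expr (k t : nat) (e : expr) : bool :=
  match e with
  | EConst _ => Nat.ltb t scratch
  | EVar a => Nat.ltb t scratch && Nat.ltb a k
  | EGet A i => Nat.ltb t scratch && (Nat.ltb A stride && wf_idx k i)
  | EAdd e1 e2 | ESub e1 e2 | EMul e1 e2 => wf_expr k t e1 && wf_expr k (S t) e2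
  end.

Fixpoint wf (k : nat) (c : com) : bool :=
  match c with
  | Skip | EmitNone => true
  | Put A i e => Nat.ltb A stride && (wf_idx k i && wf_expr k 0 e)
  | Seq c1 c2 => wf k c1 && wf k c2
  | IfLe e1 e2 c1 c2 =>
      (wf_expr k 0 e1 && wf_expr k 1 e2) && (wf k c1 && wf k c2)
  | For a c => Nat.eqb a k && wf (S k) c
  | Emit a => Nat.ltb a k
  end.

(** Linear in [n] because a loop variable never exceeds [n]; each round takes [stride] increments, a
    test, an increment of register 2 and a jump. *)
Definition acost (n : nat) : nat := 3 + (3 + stride) * n.

Fixpoint ecost (n : nat) (e : expr) : nat :=
  match e with
  | EConst _ | EVar _ => 1
  | EGet _ _ => acost n + 1
  | EAdd e1 e2 | ESub e1 e2 | EMul e1 e2 => ecost n e1 + ecost n e2 + 1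
  end.

Fixpoint cost (n : nat) (c : com) : nat :=
  match c with
  | Skip => 0
  | Put _ _ e => ecost n e + acost n + 1
  | Seq c1 c2 => cost n c1 + cost n c2
  | IfLe e1 e2 c1 c2 => ecost n e1 + ecost n e2 + 2 + cost n c1 + cost n c2
  | For _ c => 2 + n * (cost n c + 3)
  | Emit _ | EmitNone => 1
  end.

(** * Correctness of the compiled code *)

Section Simulation.

Variable prog : program.
Variable n : nat.

Definition code_at (p : nat) (l : list instr) : Prop :=
  forall k i, nth_error l k = Some i -> nth_error prog (p + k) = Some i.

Lemma code_at_app p l1 l2 :
  code_at p (l1 ++ l2) -> code_at p l1 /\ code_at (p + length l1) l2.
Proof.
  intros H; split; intros k i Hk.
  - apply H. rewrite nth_error_app1; [exact Hk|].
    apply nth_error_Some. congruence.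
  - rewrite <- Nat.add_assoc. apply H.
    rewrite nth_error_app2 by lia.
    replace (length l1 + k - length l1)%nat with k by lia. exact Hk.
Qed.

Lemma code_at_cons p i l :
  code_at p (i :: l) -> nth_error prog p = Some i /\ code_at (S p) l.
Proof.
  intros H; split.
  - rewrite <- (Nat.add_0_r p). now apply H.
  - intros k j Hk. replace (S p + k)%nat with (p + S k)%nat by lia. now apply H.
Qed.

Definition reach (B : nat) (c : config) (Q : config -> Prop) : Prop :=
  exists t, (t <= B)%nat /\ Q (run prog t c).

Lemma run_add t1 t2 c : run prog (t1 + t2) c = run prog t2 (run prog t1 c).
Proof.
  revert c; induction t1 as [|t1 IH]; intros c; [reflexivity|].
  simpl. destruct (step prog c) eqn:E; [apply IH|].
  destruct t2; simpl; [reflexivity|]. now rewrite E.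
Qed.

Lemma reach_ret B c (Q : config -> Prop) : Q c -> reach B c Q.
Proof. intros H; exists 0%nat; split; [lia|exact H]. Qed.

Lemma reach_bind B1 B2 B c Q1 Q2 :
  reach B1 c Q1 -> (forall c', Q1 c' -> reach B2 c' Q2) -> (B1 + B2 <= B)%nat ->
  reach B c Q2.
Proof.
  intros [t1 [H1 HQ1]] H HB. destruct (H _ HQ1) as [t2 [H2 HQ2]].
  exists (t1 + t2)%nat; split; [lia|]. now rewrite run_add.
Qed.

Lemma reach_step B ins c Q :
  nth_error prog (pc c) = Some ins -> ins <> Halt ->
  reach B (exec ins c) Q -> reach (S B) c Q.
Proof.
  intros H Hh [t [Ht HQ]]. exists (S t); split; [lia|].
  simpl. unfold step. rewrite H. destruct ins; try exact HQ. now elim Hh.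
Qed.

(** Nothing is claimed about the temporaries, the address registers and the counters of loops not
    yet entered, which the code may overwrite. The bound on [env] is what makes [acost] an upper
    bound. *)
Definition rel (k : nat) (env : nat -> nat) (m : nat -> nat -> R)
  (o : list (option nat)) (c : config) : Prop :=
  nm c 0%nat = n /\
  (forall a, (a < k)%nat -> nm c (6 + a) = env a /\ (env a <= n)%nat) /\
  (forall A i, (A < stride)%nat -> xm c (scratch + stride * i + A) = m A i) /\
  outrev c = o.

Lemma reach_incs q j p x a o Q B :
  code_at p (repeat (NInc q) j) ->
  (forall a', a' q = (a q + j)%nat ->
     (forall r, r <> q -> a' r = a r) ->
     reach B (Config (p + j) x a' o) Q) ->
  reach (j + B) (Config p x a o) Q.
Proof.
  revert p a; induction j as [|j IH]; intros p a Hc HQ.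
  - replace p with (p + 0)%nat by lia. apply HQ; [lia|reflexivity].
  - simpl in Hc. apply code_at_cons in Hc as [H0 Hc].
    simpl. eapply reach_step; [exact H0|discriminate|]. simpl.
    apply IH; [exact Hc|]. intros a' H1 Hr.
    rewrite Nat.add_succ_comm. apply HQ.
    + rewrite H1. unfold updN. rewrite Nat.eqb_refl. lia.
    + intros r Hne. rewrite Hr by exact Hne. unfold updN.
      destruct (Nat.eqb_spec r q); [contradiction|reflexivity].
Qed.

Lemma reach_decs q j p x a o Q B :
  code_at p (repeat (NDec q) j) ->
  (forall a', a' q = (a q - j)%nat ->
     (forall r, r <> q -> a' r = a r) ->
     reach B (Config (p + j) x a' o) Q) ->
  reach (j + B) (Config p x a o) Q.
Proof.
  revert p a; induction j as [|j IH]; intros p a Hc HQ.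
  - replace p with (p + 0)%nat by lia. apply HQ; [lia|reflexivity].
  - simpl in Hc. apply code_at_cons in Hc as [H0 Hc].
    simpl. eapply reach_step; [exact H0|discriminate|]. simpl.
    apply IH; [exact Hc|]. intros a' H1 Hr.
    rewrite Nat.add_succ_comm. apply HQ.
    + rewrite H1. unfold updN. rewrite Nat.eqb_refl. lia.
    + intros r Hne. rewrite Hr by exact Hne. unfold updN.
      destruct (Nat.eqb_spec r q); [contradiction|reflexivity].
Qed.

(** Stated for a loop that has made [v] rounds and has [j] left, the form in which induction on [j]
    goes through. *)
Lemma addr_loop p A a j v x nr o (Q : config -> Prop) :
  code_at p (addr_code p A (IVar a)) ->
  nr (6 + a)%nat = (v + j)%nat -> nr 2%nat = v ->
  nr 1%nat = (scratch + stride * v + A)%nat ->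
  (forall nr', nr' 1%nat = (scratch + stride * (v + j) + A)%nat ->
     (forall r, r <> 1%nat -> r <> 2%nat -> nr' r = nr r) ->
     Q (Config (p + (5 + stride)) x nr' o)) ->
  reach (1 + (3 + stride) * j) (Config (p + 2) x nr o) Q.
Proof.
  intros Hc. pose proof Hc as Hc0.
  apply code_at_cons in Hc as [_ Hc]. apply code_at_cons in Hc as [_ Hc].
  apply code_at_cons in Hc as [HJ Hc].
  apply code_at_app in Hc as [Hi Hc]. rewrite repeat_length in Hc.
  apply code_at_cons in Hc as [HI2 Hc]. apply code_at_cons in Hc as [HJ2 _].
  revert v nr; induction j as [|j IH]; intros v nr Ha H2 H1 HQ.
  - replace (1 + (3 + stride) * 0)%nat with 1%nat by lia.
    eapply reach_step.
    { simpl pc. replace (p + 2)%nat with (S (S p)) by lia. exact HJ. }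
    { discriminate. }
    unfold exec. rewrite Ha, H2.
    replace (Nat.leb (v + 0) v) with true by (symmetry; apply Nat.leb_le; lia).
    apply reach_ret. apply HQ; [rewrite H1; lia|reflexivity].
  - replace (1 + (3 + stride) * S j)%nat
      with (S (stride + S (S (1 + (3 + stride) * j)))) by lia.
    eapply reach_step.
    { simpl pc. replace (p + 2)%nat with (S (S p)) by lia. exact HJ. }
    { discriminate. }
    unfold exec. rewrite Ha, H2.
    replace (Nat.leb (v + S j) v) with false by (symmetry; apply Nat.leb_gt; lia).
    replace (S (p + 2)) with (S (S (S p))) by lia.
    eapply (reach_incs 1); [exact Hi|]. intros nr1 E1 Er1.
    eapply reach_step; [exact HI2|discriminate|]. unfold exec.
    eapply reach_step; [exact HJ2|discriminate|]. unfold exec.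
    apply (IH (S v)).
    + unfold updN. simpl. rewrite Er1 by lia. simpl in Ha. lia.
    + unfold updN. simpl. rewrite Er1 by lia. lia.
    + unfold updN. simpl. rewrite E1, H1. lia.
    + intros nr' E' Er'. apply HQ; [rewrite E'; lia|].
      intros r R1 R2. rewrite Er' by assumption. unfold updN.
      destruct (Nat.eqb_spec r 2); [contradiction|]. now apply Er1.
Qed.

Lemma addr_correct k env m o p A i x nr (Q : config -> Prop) :
  code_at p (addr_code p A i) -> wf_idx k i = true ->
  rel k env m o (Config p x nr o) ->
  (forall nr', nr' 1%nat = (scratch + stride * idx_val env i + A)%nat ->
     (forall r, r <> 1%nat -> r <> 2%nat -> nr' r = nr r) ->
     Q (Config (p + length (addr_code p A i)) x nr' o)) ->
  reach (acost n) (Config p x nr o) Q.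
Proof.
  intros Hc Hw [Hn [He [Ha Ho]]] HQ. destruct i as [|a].
  - apply code_at_cons in Hc as [H0 _]. unfold acost.
    eapply (reach_step (2 + (3 + stride) * n)); [exact H0|discriminate|].
    apply reach_ret. unfold exec.
    replace (S p) with (p + length (addr_code p A IZero))%nat by (simpl; lia).
    apply HQ.
    + unfold updN; simpl; lia.
    + intros r H1 H2. unfold updN. destruct (Nat.eqb_spec r 1); [contradiction|reflexivity].
  - simpl in Hw. apply Nat.ltb_lt in Hw. destruct (He a Hw) as [Hea Hle].
    pose proof Hc as Hc0.
    apply code_at_cons in Hc as [H0 Hc]. apply code_at_cons in Hc as [H1 _].
    replace (acost n) with (S (S (1 + (3 + stride) * n))) by (unfold acost; lia).
    eapply reach_step; [exact H0|discriminate|]. unfold exec.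
    eapply reach_step; [exact H1|discriminate|]. unfold exec.
    replace (S (S p)) with (p + 2)%nat by lia.
    refine (reach_bind (1 + (3 + stride) * env a) 0 _ _ _ Q
      (addr_loop p A a (env a) 0 _ _ _ Q Hc0 _ _ _ _) _ _).
    + unfold updN; simpl. exact Hea.
    + reflexivity.
    + unfold updN; simpl; lia.
    + intros nr' E1 Er. apply HQ; [exact E1|].
      intros r R1 R2. rewrite Er by assumption. unfold updN.
      destruct (Nat.eqb_spec r 2); [contradiction|].
      destruct (Nat.eqb_spec r 1); [contradiction|reflexivity].
    + intros c' HQ'. now apply reach_ret.
    + simpl in Hle. nia.
Qed.

Lemma rel_frame k env m o p x nr p' x' nr' :
  rel k env m o (Config p x nr o) ->
  (forall r, r <> 1%nat -> r <> 2%nat -> nr' r = nr r) ->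
  (forall u, (scratch <= u)%nat -> x' u = x u) ->
  rel k env m o (Config p' x' nr' o).
Proof.
  intros [Hn [He [Ha Ho]]] Hr Hx. cbn [nm xm outrev] in *.
  split; [|split; [|split]]; cbn [nm xm outrev].
  - rewrite Hr by lia. exact Hn.
  - intros a Hlt. rewrite Hr by lia. now apply He.
  - intros A i HA. rewrite Hx by lia. now apply Ha.
  - exact Ho.
Qed.

Definition epost k env m o p' x nr (t : nat) v (c : config) : Prop :=
  exists x' nr', c = Config p' x' nr' o /\
    rel k env m o c /\ x' t = v /\
    (forall u, (u < t)%nat -> x' u = x u) /\
    (forall r, r <> 1%nat -> r <> 2%nat -> nr' r = nr r).

Lemma ecomp_correct k env m o e : forall t p x nr,
  code_at p (ecomp t p e) -> wf_expr k t e = true ->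
  rel k env m o (Config p x nr o) ->
  reach (ecost n e) (Config p x nr o)
    (epost k env m o (p + length (ecomp t p e)) x nr t (eval env m e)).
Proof.
  (* One argument for the three operators: the second operand is computed in cells from [S t] on, so
     the first value survives in cell [t]. *)
  assert (Hbin : forall ins (op : R -> R -> R) t p x nr l1 l2 B1 B2 v1 v2,
    (t < scratch)%nat ->
    (forall p x nr o, exec ins (Config p x nr o)
       = Config (S p) (updR x t (op (x t) (x (S t)))) nr o) ->
    ins <> Halt ->
    code_at p (l1 ++ l2 ++ [ins]) ->
    reach B1 (Config p x nr o) (epost k env m o (p + length l1) x nr t v1) ->
    (forall x nr, rel k env m o (Config (p + length l1) x nr o) ->
       reach B2 (Config (p + length l1) x nr o)
         (epost k env m o (p + length l1 + length l2) x nr (S t) v2)) ->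
    reach (B1 + B2 + 1) (Config p x nr o)
      (epost k env m o (p + length (l1 ++ l2 ++ [ins])) x nr t (op v1 v2))).
  { intros ins op t p x nr l1 l2 B1 B2 v1 v2 Ht Hex Hh Hc H1 H2.
    apply code_at_app in Hc as [_ Hc]. apply code_at_app in Hc as [_ Hc].
    apply code_at_cons in Hc as [Hi _].
    eapply (reach_bind B1 (B2 + 1)); [exact H1| |lia].
    intros c1 (x1 & nr1 & -> & R1 & V1 & X1 & N1).
    eapply (reach_bind B2 1); [exact (H2 _ _ R1)| |lia].
    intros c2 (x2 & nr2 & -> & R2 & V2 & X2 & N2).
    eapply reach_step; [exact Hi|exact Hh|]. rewrite Hex. apply reach_ret.
    rewrite !length_app. simpl.
    exists (updR x2 t (op (x2 t) (x2 (S t)))), nr2. split; [|split; [|split; [|split]]].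
    - f_equal. lia.
    - eapply rel_frame; [exact R2|reflexivity|].
      intros u Hu. unfold updR. destruct (Nat.eqb_spec u t); [lia|reflexivity].
    - unfold updR. rewrite Nat.eqb_refl, V2, X2, V1 by lia. reflexivity.
    - intros u Hu. unfold updR. destruct (Nat.eqb_spec u t); [lia|].
      rewrite X2, X1 by lia. reflexivity.
    - intros r r1 r2. rewrite N2, N1 by assumption. reflexivity. }
  assert (Ht : forall e t, wf_expr k t e = true -> (t < scratch)%nat).
  { clear. induction e; simpl; intros t H;
      repeat match goal with H : _ && _ = true |- _ => apply andb_true_iff in H as [? ?] end;
      try (now apply Nat.ltb_lt); auto. }
  induction e as [z|a|A i|e1 IH1 e2 IH2|e1 IH1 e2 IH2|e1 IH1 e2 IH2];
    intros t p x nr Hc Hw HR; pose proof (Ht _ _ Hw) as Hlt.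
  - cbn [ecomp ecost] in *. apply code_at_cons in Hc as [H0 _].
    eapply reach_step; [exact H0|discriminate|]. apply reach_ret. unfold exec.
    exists (updR x t (IZR z)), nr. split; [|split; [|split; [|split]]].
    + f_equal; simpl; lia.
    + eapply rel_frame; [exact HR|reflexivity|].
      intros u Hu. unfold updR. destruct (Nat.eqb_spec u t); [lia|reflexivity].
    + unfold updR. now rewrite Nat.eqb_refl.
    + intros u Hu. unfold updR. destruct (Nat.eqb_spec u t); [lia|reflexivity].
    + reflexivity.
  - cbn [ecomp ecost] in *. apply code_at_cons in Hc as [H0 _].
    simpl in Hw. apply andb_true_iff in Hw as [_ Hw]. apply Nat.ltb_lt in Hw.
    eapply reach_step; [exact H0|discriminate|]. apply reach_ret. unfold exec.
    exists (updR x t (INR (nr (6 + a)%nat))), nr. split; [|split; [|split; [|split]]].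
    + f_equal; simpl; lia.
    + eapply rel_frame; [exact HR|reflexivity|].
      intros u Hu. unfold updR. destruct (Nat.eqb_spec u t); [lia|reflexivity].
    + unfold updR. rewrite Nat.eqb_refl. destruct HR as [_ [He _]].
      destruct (He a Hw) as [E _]. cbn [nm] in E. now rewrite E.
    + intros u Hu. unfold updR. destruct (Nat.eqb_spec u t); [lia|reflexivity].
    + reflexivity.
  - cbn [ecomp ecost wf_expr] in *.
    apply andb_true_iff in Hw as [_ Hw]. apply andb_true_iff in Hw as [HA Hw].
    apply Nat.ltb_lt in HA.
    apply code_at_app in Hc as [Hca Hc]. apply code_at_cons in Hc as [H0 _].
    eapply (reach_bind (acost n) 1 _ _
      (fun c => exists nr', c = Config (p + length (addr_code p A i)) x nr' o /\
         nr' 1%nat = (scratch + stride * idx_val env i + A)%nat /\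
         (forall r, r <> 1%nat -> r <> 2%nat -> nr' r = nr r))); [| |lia].
    { eapply addr_correct; [exact Hca|exact Hw|exact HR|].
      intros nr' E1 Er. now exists nr'. }
    intros c (nr' & -> & E1 & Er).
    eapply reach_step; [exact H0|discriminate|]. apply reach_ret. unfold exec.
    rewrite E1. pose proof HR as [_ [_ [Ha _]]]. cbn [xm] in Ha. rewrite Ha by exact HA.
    exists (updR x t (m A (idx_val env i))), nr'. split; [|split; [|split; [|split]]].
    + rewrite length_app. f_equal; simpl; lia.
    + eapply rel_frame; [exact HR|exact Er|].
      intros u Hu. unfold updR. destruct (Nat.eqb_spec u t); [lia|reflexivity].
    + unfold updR. now rewrite Nat.eqb_refl.
    + intros u Hu. unfold updR. destruct (Nat.eqb_spec u t); [lia|reflexivity].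
    + exact Er.
  - cbn [wf_expr ecomp ecost eval] in *. apply andb_true_iff in Hw as [Hw1 Hw2].
    pose proof (code_at_app _ _ _ Hc) as [Hc1 Hc2]. apply code_at_app in Hc2 as [Hc2 _].
    eapply (Hbin _ Rplus); [exact Hlt| |discriminate|exact Hc|now apply IH1|].
    + reflexivity.
    + intros x' nr' HR'. now apply IH2.
  - cbn [wf_expr ecomp ecost eval] in *. apply andb_true_iff in Hw as [Hw1 Hw2].
    pose proof (code_at_app _ _ _ Hc) as [Hc1 Hc2]. apply code_at_app in Hc2 as [Hc2 _].
    eapply (Hbin _ Rminus); [exact Hlt| |discriminate|exact Hc|now apply IH1|].
    + reflexivity.
    + intros x' nr' HR'. now apply IH2.
  - cbn [wf_expr ecomp ecost eval] in *. apply andb_true_iff in Hw as [Hw1 Hw2].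
    pose proof (code_at_app _ _ _ Hc) as [Hc1 Hc2]. apply code_at_app in Hc2 as [Hc2 _].
    eapply (Hbin _ Rmult); [exact Hlt| |discriminate|exact Hc|now apply IH1|].
    + reflexivity.
    + intros x' nr' HR'. now apply IH2.
Qed.

Definition cpost k env s p' (c : config) : Prop :=
  pc c = p' /\ rel k env (arr s) (out s) c.

Lemma reach_weaken B B' c (Q Q' : config -> Prop) :
  reach B c Q -> (forall c', Q c' -> Q' c') -> (B <= B')%nat -> reach B' c Q'.
Proof. intros [t [Ht H]] HQ HB. exists t; split; [lia|auto]. Qed.

Lemma comp_correct c : forall k env s p cfg,
  code_at p (comp p c) -> wf k c = true -> cpost k env s p cfg ->
  reach (cost n c) cfg (cpost k env (sem n c env s) (p + length (comp p c))).
Proof.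
  induction c as [|A i e|c1 IH1 c2 IH2|e1 e2 c1 IH1 c2 IH2|a c IH|a|];
    intros k env s p cfg Hc Hw [Hp HR].
  - apply reach_ret. split; [simpl; lia|exact HR].
  - cbn [comp wf cost] in *. destruct cfg as [p0 x nr o]. cbn [pc] in Hp. subst p0.
    assert (o = out s) by exact (proj2 (proj2 (proj2 HR))). subst o.
    apply andb_true_iff in Hw as [HA Hw]. apply andb_true_iff in Hw as [Hwi Hwe].
    apply Nat.ltb_lt in HA.
    apply code_at_app in Hc as [Hce Hc]. apply code_at_app in Hc as [Hca Hc].
    apply code_at_cons in Hc as [Hst _].
    eapply (reach_bind (ecost n e) (acost n + 1));
      [exact (ecomp_correct _ _ _ _ _ _ _ _ _ Hce Hwe HR)| |lia].
    intros c1 (x1 & nr1 & -> & R1 & V1 & X1 & N1).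
    set (p1 := (p + length (ecomp 0 p e))%nat) in *.
    eapply (reach_bind (acost n) 1 _ _
      (fun c => exists nr', c = Config (p1 + length (addr_code p1 A i)) x1 nr' (out s) /\
         nr' 1%nat = (scratch + stride * idx_val env i + A)%nat /\
         (forall r, r <> 1%nat -> r <> 2%nat -> nr' r = nr1 r))); [| |lia].
    { eapply addr_correct; [exact Hca|exact Hwi|exact R1|].
      intros nr' E1 Er. now exists nr'. }
    intros c (nr' & -> & E1 & Er).
    eapply reach_step; [exact Hst|discriminate|]. apply reach_ret. unfold exec.
    rewrite E1, V1. split.
    + rewrite !length_app. simpl. lia.
    + cbn [sem arr out]. destruct R1 as [Hn [He [Ha Ho]]]. cbn [nm xm outrev] in *.
      split; [|split; [|split]]; cbn [nm xm outrev].
      * rewrite Er by lia. exact Hn.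
      * intros a Hlt. rewrite Er by lia. now apply He.
      * intros A' i' HA'. unfold upd_arr, updR.
        (* As [A] and [A'] are below [stride], an address determines both array and index, so no
           other entry is overwritten. *)
        destruct (Nat.eqb_spec (scratch + stride * i' + A')
                    (scratch + stride * idx_val env i + A)) as [Eq|Ne].
        -- assert (A' = A /\ i' = idx_val env i) as [-> ->] by lia.
           now rewrite !Nat.eqb_refl.
        -- destruct (Nat.eqb_spec A' A); [|now apply Ha].
           destruct (Nat.eqb_spec i' (idx_val env i)); [|now apply Ha].
           subst. now elim Ne.
      * reflexivity.
  - cbn [comp wf cost sem] in *. apply andb_true_iff in Hw as [Hw1 Hw2].
    apply code_at_app in Hc as [Hc1 Hc2].
    eapply reach_bind; [exact (IH1 _ _ _ _ _ Hc1 Hw1 (conj Hp HR))| |reflexivity].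
    intros c' Hpost. rewrite length_app, Nat.add_assoc.
    exact (IH2 _ _ _ _ _ Hc2 Hw2 Hpost).
  - cbn [comp wf cost sem] in *. destruct cfg as [p0 x nr o]. cbn [pc] in Hp. subst p0.
    assert (o = out s) by exact (proj2 (proj2 (proj2 HR))). subst o.
    apply andb_true_iff in Hw as [Hwe Hw]. apply andb_true_iff in Hw as [Hw1 Hw2].
    apply andb_true_iff in Hwe as [Hwe1 Hwe2].
    set (l1 := ecomp 0 p e1) in *.
    set (l2 := ecomp 1 (p + length l1) e2) in *.
    set (p2 := (p + length l1 + length l2 + 1)%nat) in *.
    set (lf := comp p2 c2) in *.
    set (pt := (p2 + length lf + 1)%nat) in *.
    set (lt := comp pt c1) in *.
    apply code_at_app in Hc as [Hc1 Hc]. apply code_at_app in Hc as [Hc2 Hc].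
    apply code_at_cons in Hc as [HJ Hc]. apply code_at_app in Hc as [Hcf Hc].
    apply code_at_cons in Hc as [HJ2 Hct].
    rewrite !length_app. cbn [length].
    replace (S (p + length l1 + length l2)) with p2 in * by (unfold p2; lia).
    replace (S (p2 + length lf)) with pt in * by (unfold pt; lia).
    eapply (reach_bind (ecost n e1) (ecost n e2 + 2 + cost n c1 + cost n c2));
      [exact (ecomp_correct _ _ _ _ _ _ _ _ _ Hc1 Hwe1 HR)| |lia].
    intros c' (x1 & nr1 & -> & R1 & V1 & X1 & N1).
    eapply (reach_bind (ecost n e2) (2 + cost n c1 + cost n c2));
      [exact (ecomp_correct _ _ _ _ _ _ _ _ _ Hc2 Hwe2 R1)| |lia].
    intros c' (x2 & nr2 & -> & R2 & V2 & X2 & N2).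
    eapply (reach_step (1 + cost n c1 + cost n c2)); [exact HJ|discriminate|].
    unfold exec. rewrite V2, X2, V1 by lia.
    destruct (Rle_dec (eval env (arr s) e1) (eval env (arr s) e2)).
    + eapply reach_weaken.
      * apply (IH1 _ env s _ _ Hct Hw1). split; [reflexivity|].
        eapply rel_frame; [exact R2|reflexivity|reflexivity].
      * intros c' [Hp' Hr']. split; [|exact Hr']. rewrite Hp'. fold lt. unfold pt, p2. lia.
      * lia.
    + eapply (reach_bind (cost n c2) 1).
      * apply (IH2 _ env s _ (Config (S (p + length l1 + length l2)) x2 nr2 (out s)) Hcf Hw2).
        split; [simpl; unfold p2; lia|].
        eapply rel_frame; [exact R2|reflexivity|reflexivity].
      * intros [p' x' nr' o'] [Hp' Hr']. cbn [pc] in Hp'. subst p'.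
        eapply reach_step; [exact HJ2|discriminate|]. apply reach_ret. unfold exec.
        split; [simpl; unfold pt, p2; lia|]. exact Hr'.
      * lia.
  - cbn [comp wf cost sem] in *. apply andb_true_iff in Hw as [Hak Hw].
    apply Nat.eqb_eq in Hak. subst a.
    set (l := comp (p + 2) c) in *.
    apply code_at_cons in Hc as [HC Hc]. apply code_at_cons in Hc as [HJ Hc].
    apply code_at_app in Hc as [Hl Hc]. apply code_at_cons in Hc as [HI Hc].
    apply code_at_cons in Hc as [HJ2 _].
    replace (S (S p)) with (p + 2)%nat in * by lia.
    destruct cfg as [p0 x nr o]. cbn [pc] in Hp. subst p0.
    eapply (reach_step (1 + n * (cost n c + 3))); [exact HC|discriminate|]. unfold exec.
    set (f := fun (i : nat) (s0 : store) => sem n c (updN env k i) s0).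
    (* Invariant at the loop test. The counter, register [6 + k], lies outside the scope of [rel k];
       within the body, under [rel (S k)], it is an ordinary loop variable. *)
    set (I := fun j cfg => pc cfg = S p /\ nm cfg (6 + k)%nat = j /\
                rel k env (arr (loop j f s)) (out (loop j f s)) cfg).
    assert (HI0 : I 0%nat (Config (S p) x (updN nr (6 + k) 0) o)).
    { split; [reflexivity|]. split; [simpl; unfold updN; now rewrite Nat.eqb_refl|].
      destruct HR as [Hn [He [Ha Ho]]]. cbn [nm xm outrev loop] in *.
      split; [|split; [|split]]; cbn [nm xm outrev].
      - exact Hn.
      - intros a Hlt. unfold updN. destruct (Nat.eqb_spec (6 + a) (6 + k)); [lia|]. now apply He.
      - exact Ha.
      - exact Ho. }
    assert (Hbody : forall j cfg, (j < n)%nat -> I j cfg ->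
              reach (cost n c + 3) cfg (I (S j))).
    { intros j [p' x' nr' o'] Hj (Hp' & Hk' & Hr'). cbn [pc nm] in Hp', Hk'. subst p'.
      rewrite Nat.add_comm. eapply (reach_step (2 + cost n c)); [exact HJ|discriminate|].
      assert (Hn' : nr' 0%nat = n) by exact (proj1 Hr').
      unfold exec. rewrite Hn', Hk'.
      replace (Nat.leb n j) with false by (symmetry; apply Nat.leb_gt; lia).
      replace (S (S p)) with (p + 2)%nat by lia.
      eapply (reach_bind (cost n c) 2).
      - apply (IH (S k) (updN env k j) (loop j f s) _ _ Hl Hw).
        split; [reflexivity|].
        destruct Hr' as [Hn1 [He [Ha Ho]]]. cbn [nm xm outrev] in *.
        split; [exact Hn1|split; [|split; [exact Ha|exact Ho]]]. cbn [nm].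
        intros a Ha'. unfold updN. destruct (Nat.eqb_spec a k).
        + subst a. split; [exact Hk'|lia].
        + apply He. lia.
      - intros [p1 x1 nr1 o1] [Hp1 Hr1]. cbn [pc] in Hp1. subst p1.
        eapply reach_step; [exact HI|discriminate|]. unfold exec.
        eapply reach_step; [exact HJ2|discriminate|]. unfold exec.
        apply reach_ret. destruct Hr1 as [Hn1 [He [Ha Ho]]]. cbn [nm xm outrev] in *.
        split; [simpl; lia|split].
        + cbn [nm]. unfold updN at 1. rewrite Nat.eqb_refl.
          destruct (He k (Nat.lt_succ_diag_r k)) as [E _]. rewrite E.
          unfold updN. now rewrite Nat.eqb_refl.
        + cbn [loop]. change (f j (loop j f s)) with (sem n c (updN env k j) (loop j f s)).
          split; [|split; [|split]]; cbn [nm xm outrev].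
          * exact Hn1.
          * intros a Hlt. destruct (He a (Nat.lt_lt_succ_r _ _ Hlt)) as [E L].
            unfold updN at 1. destruct (Nat.eqb_spec (6 + a) (6 + k)); [lia|].
            rewrite E. unfold updN in *. destruct (Nat.eqb_spec a k); [lia|]. now split.
          * exact Ha.
          * exact Ho.
      - lia. }
    assert (Hall : forall j, (j <= n)%nat ->
              reach (j * (cost n c + 3)) (Config (S p) x (updN nr (6 + k) 0) o) (I j)).
    { induction j as [|j IHj]; intros Hj.
      - now apply reach_ret.
      - eapply reach_bind; [apply IHj; lia| |]; [intros c' Hc'; apply Hbody; [lia|exact Hc']|].
        simpl. lia. }
    eapply (reach_bind (n * (cost n c + 3)) 1); [apply Hall; lia| |lia].
    intros [p' x' nr' o'] (Hp' & Hk' & Hr'). cbn [pc nm] in Hp', Hk'. subst p'.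
    eapply reach_step; [exact HJ|discriminate|].
    assert (Hn' : nr' 0%nat = n) by exact (proj1 Hr').
    unfold exec. rewrite Hn', Hk', Nat.leb_refl. apply reach_ret.
    split; [|exact Hr'].
    cbn [pc length app]. rewrite length_app. cbn [length]. lia.
  - cbn [comp wf cost sem] in *. apply Nat.ltb_lt in Hw.
    apply code_at_cons in Hc as [H0 _]. destruct cfg as [p0 x nr o]. cbn [pc] in Hp. subst p0.
    eapply reach_step; [exact H0|discriminate|]. apply reach_ret. unfold exec.
    destruct HR as [Hn [He [Ha Ho]]]. cbn [nm xm outrev] in *.
    split; [simpl; lia|]. split; [exact Hn|split; [exact He|split; [exact Ha|]]].
    cbn [outrev out]. destruct (He a Hw) as [E _]. now rewrite E, Ho.
  - cbn [comp wf cost sem] in *.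
    apply code_at_cons in Hc as [H0 _]. destruct cfg as [p0 x nr o]. cbn [pc] in Hp. subst p0.
    eapply reach_step; [exact H0|discriminate|]. apply reach_ret. unfold exec.
    destruct HR as [Hn [He [Ha Ho]]]. cbn [nm xm outrev] in *.
    split; [simpl; lia|]. split; [exact Hn|split; [exact He|split; [exact Ha|]]].
    cbn [outrev out]. now rewrite Ho.
Qed.

End Simulation.

(* The input occupies the cells needed as temporaries, so it is first moved to
   its place in the array layout, from the last point down; cell 0 serves as the
   transfer cell, and its initial content is parked behind the arrays. *)
Definition prologue : list instr :=
  [NConst 1 0; NConst 2 scratch; NConst 3 0; JLeN 0 3 (8 + stride); NInc 1; NInc 1]
  ++ repeat (NInc 2) stride ++ [NInc 3; Jmp 3]
  ++ [NCopy 5 2; RStoreInd 2 0; JLeN 3 4 (19 + 2 * stride); NDec 3; NDec 1]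
  ++ repeat (NDec 2) (stride - 1)
  ++ [RLoadInd 0 1; RStoreInd 2 0; NDec 1; NDec 2; RLoadInd 0 1; RStoreInd 2 0;
      Jmp (10 + stride)]
  ++ [RLoadInd 0 5; RStoreInd 2 0].

Ltac upd_simpl :=
  unfold updN, updR in *; repeat match goal with
  | |- context [Nat.eqb ?a ?b] => destruct (Nat.eqb_spec a b); try lia
  end.

Lemma prologue_correct rest x0 n :
  let prog := prologue ++ rest in
  let a0 := fun k => if Nat.eqb k 0 then n else 0%nat in
  reach prog (100 + 100 * n) (Config 0 x0 a0 [])
    (fun c => pc c = length prologue /\ nm c 0%nat = n /\ outrev c = [] /\
       forall i, (i < n)%nat -> xm c (scratch + stride * i + 0)%nat = x0 (2 * i)%nat /\
         xm c (scratch + stride * i + 1)%nat = x0 (2 * i + 1)%nat).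
Proof.
  intros prog a0.
  assert (Hc2 : code_at prog 6 (repeat (NInc 2) 24)).
  { intros k i Hk. do 24 (destruct k as [|k]; [exact Hk|]). destruct k; discriminate. }
  assert (Hc5 : code_at prog 37 (repeat (NDec 2) 23)).
  { intros k i Hk. do 23 (destruct k as [|k]; [exact Hk|]). destruct k; discriminate. }
  set (I1 := fun j c => exists nr, c = Config 3 x0 nr [] /\ nr 0%nat = n /\
    nr 1%nat = (2 * j)%nat /\ nr 2%nat = (16 + 24 * j)%nat /\ nr 3%nat = j /\ nr 4%nat = 0%nat).
  (* Points [k] and up have been moved. Input cells below [2 * k] other than cell 0 are intact,
     because every destination so far lies beyond them. Point 0 receives a wrong first coordinate,
     cell 0 being the transfer cell, hence the exception; the last two instructions restore it from
     cell [16 + 24 * n]. *)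
  set (I2 := fun k c => exists x nr, c = Config 34 x nr [] /\ nr 0%nat = n /\
    nr 1%nat = (2 * k)%nat /\ nr 2%nat = (16 + 24 * k)%nat /\ nr 3%nat = k /\
    nr 4%nat = 0%nat /\ nr 5%nat = (16 + 24 * n)%nat /\
    x (16 + 24 * n)%nat = x0 0%nat /\
    (forall u, (0 < u < 2 * k)%nat -> x u = x0 u) /\
    (forall i, (k <= i < n)%nat ->
       (i <> 0%nat -> x (16 + 24 * i + 0)%nat = x0 (2 * i)%nat) /\
       x (16 + 24 * i + 1)%nat = x0 (2 * i + 1)%nat)).
  assert (HJ1 : nth_error prog 3 = Some (JLeN 0 3 32)) by reflexivity.
  assert (HJ2 : nth_error prog 34 = Some (JLeN 3 4 67)) by reflexivity.
  assert (L1 : forall j, (j <= n)%nat -> reach prog (3 + 30 * j) (Config 0 x0 a0 []) (I1 j)).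
  { induction j as [|j IHj]; intros Hj.
    - do 3 (eapply reach_step; [reflexivity|discriminate|]; unfold exec).
      apply reach_ret. eexists; split; [reflexivity|]. repeat split.
    - eapply (reach_bind _ (3 + 30 * j) 30); [apply IHj; lia| |lia].
      intros c (nr & -> & E0 & E1 & E2 & E3 & E4).
      eapply (reach_step _ 29); [exact HJ1|discriminate|]. unfold exec. rewrite E0, E3.
      replace (Nat.leb n j) with false by (symmetry; apply Nat.leb_gt; lia).
      do 2 (eapply reach_step; [reflexivity|discriminate|]; unfold exec).
      eapply (reach_incs _ 2 24 _ _ _ _ _ 3); [exact Hc2|].
      intros nr' F2 Fr.
      do 2 (eapply reach_step; [reflexivity|discriminate|]; unfold exec).
      apply reach_ret. eexists; split; [reflexivity|].
      unfold updN in F2, Fr |- *; cbn [Nat.eqb] in *.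
      pose proof (Fr 0%nat ltac:(lia)) as G0. pose proof (Fr 1%nat ltac:(lia)) as G1.
      pose proof (Fr 3%nat ltac:(lia)) as G3. pose proof (Fr 4%nat ltac:(lia)) as G4.
      cbn [Nat.eqb] in *. repeat split; lia. }
  eapply (reach_bind _ (3 + 30 * n) (97 + 70 * n)); [apply (L1 n); lia| |lia].
  intros c (nr & -> & E0 & E1 & E2 & E3 & E4).
  assert (L2 : forall k, (k <= n)%nat -> reach prog (3 + 40 * k) (Config 3 x0 nr []) (I2 (n - k)%nat)).
  { induction k as [|k IHk]; intros Hk.
    - eapply reach_step; [exact HJ1|discriminate|]. unfold exec. rewrite E0, E3, Nat.leb_refl.
      do 2 (eapply reach_step; [reflexivity|discriminate|]; unfold exec).
      apply reach_ret. eexists; eexists; split; [reflexivity|].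
      unfold updN, updR; cbn [Nat.eqb]. rewrite Nat.sub_0_r.
      repeat split; try lia; try (rewrite E2).
      + now rewrite Nat.eqb_refl.
      + intros u Hu. destruct (Nat.eqb_spec u (16 + 24 * n)); [lia|reflexivity].
    - eapply (reach_bind _ (3 + 40 * k) 40); [apply IHk; lia| |lia].
      remember (n - S k)%nat as j. replace (n - k)%nat with (S j) by lia.
      intros c (x & ar & -> & F0 & F1 & F2 & F3 & F4 & F5 & Fs & Fl & Fh).
      eapply (reach_step _ 39); [exact HJ2|discriminate|]. unfold exec. rewrite F3, F4.
      cbn [Nat.leb].
      do 2 (eapply reach_step; [reflexivity|discriminate|]; unfold exec).
      eapply (reach_decs _ 2 23 _ _ _ _ _ 14); [exact Hc5|].
      intros ar' G2 Gr. cbn [Nat.add].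
      assert (K0 : ar' 0%nat = n) by (rewrite Gr by lia; exact F0).
      assert (K1 : ar' 1%nat = (2 * j + 1)%nat).
      { rewrite Gr by lia. unfold updN; cbn [Nat.eqb]. rewrite F1; lia. }
      assert (K2 : ar' 2%nat = (16 + 24 * j + 1)%nat).
      { rewrite G2. unfold updN; cbn [Nat.eqb]. rewrite F2; lia. }
      assert (K3 : ar' 3%nat = j).
      { rewrite Gr by lia. unfold updN; cbn [Nat.eqb]. rewrite F3; lia. }
      assert (K4 : ar' 4%nat = 0%nat) by (rewrite Gr by lia; exact F4).
      assert (K5 : ar' 5%nat = (16 + 24 * n)%nat) by (rewrite Gr by lia; exact F5).
      do 7 (eapply reach_step; [reflexivity|discriminate|]; unfold exec).
      apply reach_ret. eexists; eexists; split; [reflexivity|].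
      unfold updN; cbn [Nat.eqb]. rewrite K1, K2.
      replace (Nat.pred (2 * j + 1)) with (2 * j)%nat by lia.
      replace (Nat.pred (16 + 24 * j + 1)) with (16 + 24 * j)%nat by lia.
      split; [exact K0|]. split; [reflexivity|]. split; [reflexivity|].
      split; [exact K3|]. split; [exact K4|]. split; [exact K5|].
      split; [|split].
      + upd_simpl. exact Fs.
      + intros u Hu. upd_simpl. apply Fl; lia.
      + intros i Hi. destruct (Nat.eq_dec i j) as [->|Hne].
        * split; [intros Hj0|]; upd_simpl; apply Fl; lia.
        * assert (Hi' : (S j <= i < n)%nat) by lia. destruct (Fh i Hi') as [A B].
          split; [intros Hi0; specialize (A Hi0)|]; upd_simpl; assumption. }
  eapply (reach_bind _ (3 + 40 * n) 3); [apply (L2 n); lia| |lia].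
  rewrite Nat.sub_diag.
  intros c (x & ar & -> & F0 & F1 & F2 & F3 & F4 & F5 & Fs & Fl & Fh).
  eapply reach_step; [exact HJ2|discriminate|]. unfold exec. rewrite F3, F4. cbn [Nat.leb].
  do 2 (eapply reach_step; [reflexivity|discriminate|]; unfold exec).
  apply reach_ret. split; [reflexivity|]. split; [exact F0|]. split; [reflexivity|].
  cbn [xm]. rewrite F2, F5, Fs. intros i Hi.
  assert (Hi' : (0 <= i < n)%nat) by lia. destruct (Fh i Hi') as [A B].
  destruct (Nat.eq_dec i 0) as [->|Hi0].
  - split; [upd_simpl; reflexivity|upd_simpl; assumption].
  - specialize (A Hi0). split; upd_simpl; assumption.
Qed.

(** * Polynomial running time *)

Definition poly (f : nat -> nat) : Prop :=
  exists C d, forall n, (f n <= C * (n + 1) ^ d)%nat.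

Lemma poly_const k : poly (fun _ => k).
Proof. exists k, 0%nat. intros n; simpl; lia. Qed.

Lemma poly_id : poly (fun n => n).
Proof. exists 1%nat, 1%nat. intros n; simpl; lia. Qed.

Lemma poly_add f g : poly f -> poly g -> poly (fun n => f n + g n)%nat.
Proof.
  intros (C1 & d1 & H1) (C2 & d2 & H2). exists (C1 + C2)%nat, (d1 + d2)%nat.
  intros n. specialize (H1 n); specialize (H2 n).
  assert (A1 : ((n + 1) ^ d1 <= (n + 1) ^ (d1 + d2))%nat) by (apply Nat.pow_le_mono_r; lia).
  assert (A2 : ((n + 1) ^ d2 <= (n + 1) ^ (d1 + d2))%nat) by (apply Nat.pow_le_mono_r; lia).
  nia.
Qed.

Lemma poly_mul f g : poly f -> poly g -> poly (fun n => f n * g n)%nat.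
Proof.
  intros (C1 & d1 & H1) (C2 & d2 & H2). exists (C1 * C2)%nat, (d1 + d2)%nat.
  intros n. specialize (H1 n); specialize (H2 n). rewrite Nat.pow_add_r.
  replace (C1 * C2 * ((n + 1) ^ d1 * (n + 1) ^ d2))%nat
    with ((C1 * (n + 1) ^ d1) * (C2 * (n + 1) ^ d2))%nat by ring.
  now apply Nat.mul_le_mono.
Qed.

(** Each loop multiplies the cost by about [n], so the degree is governed by the nesting depth,
    which is fixed with the program. *)
Lemma poly_cost c : poly (fun n => cost n c).
Proof.
  assert (Ha : poly acost).
  { unfold acost. apply poly_add; [apply poly_const|].
    apply poly_mul; [apply poly_const|apply poly_id]. }
  assert (He : forall e, poly (fun n => ecost n e)).
  { induction e; cbn [ecost];
      auto using poly_const, poly_add. }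
  induction c; cbn [cost];
    auto 10 using poly_const, poly_id, poly_add, poly_mul.
Qed.

Lemma poly_bound f : poly f ->
  exists C d, forall n, (f n <= C * n ^ d + C)%nat.
Proof.
  intros (C & d & H). exists (C * 2 ^ d)%nat, d. intros n. specialize (H n).
  assert (P2 : (1 <= 2 ^ d)%nat) by (apply Nat.neq_0_le_1, Nat.pow_nonzero; lia).
  destruct n as [|n].
  - rewrite Nat.pow_1_l in H. nia.
  - assert (A : ((S n + 1) ^ d <= 2 ^ d * (S n) ^ d)%nat).
    { rewrite <- Nat.pow_mul_l. apply Nat.pow_le_mono_l. lia. }
    nia.
Qed.

(** The initial store is existential because only the two coordinate arrays are known: the other
    arrays may hold remains of the raw input, so programs must initialise what they read. *)
Theorem compile_correct c : wf 0 c = true ->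
  exists (prog : program) (C d : nat), forall P : list pt,
    exists s0 : store,
      (forall i, (i < length P)%nat ->
         arr s0 0%nat i = fst (nth i P (0, 0)) /\ arr s0 1%nat i = snd (nth i P (0, 0))) /\
      out s0 = [] /\
      halts_within prog (C * length P ^ d + C) (init_config P)
        (rev (out (sem (length P) c (fun _ => 0%nat) s0))).
Proof.
  intros Hw.
  set (code := comp (length prologue) c).
  destruct (poly_bound (fun n => (100 + 100 * n) + cost n c)%nat) as (C & d & HB).
  { apply poly_add; [|apply poly_cost].
    apply poly_add; [apply poly_const|]. apply poly_mul; [apply poly_const|apply poly_id]. }
  exists (prologue ++ code), C, d. intros P. set (n := length P).
  destruct (prologue_correct code (xm (init_config P)) n) as (t1 & Ht1 & Hpc & Hn & Ho & Hx).
  change (Config 0 (xm (init_config P)) _ []) with (init_config P) in *.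
  set (c1 := run (prologue ++ code) t1 (init_config P)) in *.
  set (s0 := Store (fun A i => xm c1 (scratch + stride * i + A)%nat) []).
  exists s0. split; [|split; [reflexivity|]].
  - intros i Hi. destruct (Hx i Hi) as [E0 E1]. cbn [arr s0]. rewrite E0, E1.
    unfold init_config; cbn [xm].
    rewrite Nat.div2_double. replace (2 * i + 1)%nat with (S (2 * i)) by lia.
    rewrite Nat.div2_succ_double, (nth_error_nth' P (0, 0) Hi).
    rewrite Nat.even_succ, <- Nat.negb_even, Nat.even_mul. now split.
  - destruct (comp_correct (prologue ++ code) n c 0 (fun _ => 0%nat) s0 (length prologue) c1)
      as (t2 & Ht2 & Hpc2 & Hr2).
    + intros k i Hk. fold code in Hk. rewrite nth_error_app2 by lia.
      replace (length prologue + k - length prologue)%nat with k by lia. exact Hk.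
    + exact Hw.
    + split; [exact Hpc|]. split; [exact Hn|]. split; [intros a Ha; lia|].
      split; [reflexivity|exact Ho].
    + set (c2 := run (prologue ++ code) t2 c1) in *.
      assert (Hstop : step (prologue ++ code) c2 = None).
      { unfold step. rewrite Hpc2. fold code.
        rewrite (proj2 (nth_error_None _ _)); [reflexivity|]. rewrite length_app. lia. }
      assert (Hrun : run (prologue ++ code) (C * n ^ d + C) (init_config P) = c2).
      { specialize (HB n).
        replace (C * n ^ d + C)%nat with (t1 + (t2 + (C * n ^ d + C - t1 - t2)))%nat by lia.
        rewrite !run_add. fold c1. fold c2.
        destruct (C * n ^ d + C - t1 - t2)%nat; [reflexivity|]. cbn [run]. now rewrite Hstop. }
      unfold halts_within. rewrite Hrun. split; [exact Hstop|].
      now rewrite (proj2 (proj2 (proj2 Hr2))).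
Qed.

(** * Covering by disks centred at input points *)

Lemma bernoulli_nat q m : (q ^ m * (q + m) <= q * (q + 1) ^ m)%nat.
Proof.
  induction m as [|m IH]; [simpl; lia|].
  rewrite !Nat.pow_succ_r'.
  assert (H : ((q + 1) * (q ^ m * (q + m)) <= (q + 1) * (q * (q + 1) ^ m))%nat)
    by (apply Nat.mul_le_mono_l; exact IH).
  assert (H2 : (q * q ^ m * (q + S m) <= (q + 1) * (q ^ m * (q + m)))%nat).
  { generalize (q ^ m)%nat; intros x. nia. }
  lia.
Qed.

(* With [K := 2 ^ i], the factor [4 ^ (i + 3)] is the quadratic bound [64 K^2] of
   [packing_ball], which is beaten by [(1 + 1/q)^K]. *)
Lemma exponential_beats_packing q : (1 <= q)%nat ->
  exists i, (4 ^ (i + 3) * q ^ (2 ^ i) < (q + 1) ^ (2 ^ i))%nat.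
Proof.
  (* By Bernoulli [(1 + 1/q)^q >= 2], so the exponent [q * t] yields [2^t], and [t = 2 * i + 7]
     makes this [2 * 4^(i + 3)], the spare factor 2 giving strictness. The value of [i] is large
     enough for [q * t <= 2^i]. *)
  intros Hq. set (i := (2 * q + 8)%nat). exists i. set (t := (2 * i + 7)%nat).
  assert (Hpow : forall m, (m + 1 <= 2 ^ m)%nat).
  { induction m as [|m IH]; [simpl; lia|]. rewrite Nat.pow_succ_r'. lia. }
  assert (Hi : (q * t <= 2 ^ i)%nat).
  { unfold t, i. rewrite Nat.pow_add_r, Nat.pow_mul_r.
    change (2 ^ 8)%nat with 256%nat.
    replace ((2 ^ 2) ^ q)%nat with (2 ^ q * 2 ^ q)%nat.
    - specialize (Hpow q). nia.
    - rewrite <- Nat.pow_mul_l. reflexivity. }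
  assert (H2 : (2 * q ^ q <= (q + 1) ^ q)%nat).
  { pose proof (bernoulli_nat q q) as B. nia. }
  assert (H3 : (2 ^ t * q ^ (q * t) <= (q + 1) ^ (q * t))%nat).
  { rewrite !Nat.pow_mul_r, <- Nat.pow_mul_l. now apply Nat.pow_le_mono_l. }
  set (r := (2 ^ i - q * t)%nat).
  assert (E : (2 ^ i = q * t + r)%nat) by (unfold r; lia).
  rewrite E, !Nat.pow_add_r.
  assert (H4 : (q ^ r <= (q + 1) ^ r)%nat) by (apply Nat.pow_le_mono_l; lia).
  assert (H5 : (2 ^ t = 2 * (4 ^ i * 4 ^ 3))%nat).
  { unfold t. rewrite Nat.pow_add_r, Nat.pow_mul_r. change (2 ^ 2)%nat with 4%nat.
    change (2 ^ 7)%nat with 128%nat. change (4 ^ 3)%nat with 64%nat. lia. }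
  assert (P1 : (1 <= q ^ r)%nat) by (apply Nat.neq_0_le_1, Nat.pow_nonzero; lia).
  assert (P2 : (1 <= q ^ (q * t))%nat) by (apply Nat.neq_0_le_1, Nat.pow_nonzero; lia).
  assert (P3 : (1 <= 4 ^ i * 4 ^ 3)%nat).
  { pose proof (Nat.pow_nonzero 4 i). change (4 ^ 3)%nat with 64%nat. lia. }
  rewrite H5 in H3. revert H3 H4 P1 P2 P3.
  generalize (4 ^ i * 4 ^ 3)%nat (q ^ (q * t))%nat (q ^ r)%nat
    ((q + 1) ^ (q * t))%nat ((q + 1) ^ r)%nat.
  intros a b c d e H3 H4 P1 P2 P3.
  assert (a * b < d)%nat by nia. nia.
Qed.

Section Geometry.

Variable n : nat.
Variables px py : nat -> R.

Definition sqd (i j : nat) : R :=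
  (px i - px j) * (px i - px j) + (py i - py j) * (py i - py j).

(** Squared, so that the tests of the program evaluate exactly this relation. *)
Definition near (r : R) (c p : nat) : Prop := sqd c p <= r * r.

Lemma near_sym r c p : near r c p -> near r p c.
Proof. unfold near, sqd; nra. Qed.

Lemma near_refl r p : near r p p.
Proof. unfold near, sqd; nra. Qed.

Lemma near_mono r r' c p : 0 <= r <= r' -> near r c p -> near r' c p.
Proof. unfold near; nra. Qed.

Lemma near_trans r t a b c : 0 <= r -> 0 <= t ->
  near r a b -> near t b c -> near (r + t) a c.
Proof.
  unfold near, sqd. intros Hr Ht H1 H2.
  set (u1 := px a - px b) in *. set (u2 := py a - py b) in *.
  set (w1 := px b - px c) in *. set (w2 := py b - py c) in *.
  replace (px a - px c) with (u1 + w1) by (unfold u1, w1; ring).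
  replace (py a - py c) with (u2 + w2) by (unfold u2, w2; ring).
  (* Cauchy-Schwarz: the two sides of [A] differ by the square of [u1 * w2 - u2 * w1]. *)
  assert (Hp : (u1 * w1 + u2 * w2) * (u1 * w1 + u2 * w2) <= (r * t) * (r * t)).
  { assert (A : (u1 * w1 + u2 * w2) * (u1 * w1 + u2 * w2)
                <= (u1 * u1 + u2 * u2) * (w1 * w1 + w2 * w2)).
    { pose proof (Rle_0_sqr (u1 * w2 - u2 * w1)) as S. unfold Rsqr in S. lra. }
    assert (B : (u1 * u1 + u2 * u2) * (w1 * w1 + w2 * w2) <= (r * r) * (t * t)).
    { apply Rmult_le_compat; try assumption; nra. }
    lra. }
  assert (Hq : u1 * w1 + u2 * w2 <= r * t) by (assert (0 <= r * t) by nra; nra).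
  nra.
Qed.

Definition covers (r : R) (C T : nat -> Prop) : Prop :=
  forall p, (p < n)%nat -> T p -> exists c, (c < n)%nat /\ C c /\ near r c p.

Definition member (t : list nat) : nat -> Prop := fun c => In c t.

(** Quarter the square until the cells have side [h]. Any target point in such a cell covers all
    others in it, the diameter [sqrt 2 * h] being at most [r]; so the centres are input points, as
    required. *)
Lemma packing_square (r h : R) : 0 <= h -> r = 2 * h ->
  forall i ax ay (T : nat -> Prop),
  (forall p, (p < n)%nat -> T p -> ax <= px p <= ax + 2 ^ i * h /\ ay <= py p <= ay + 2 ^ i * h) ->
  exists t, (length t <= 4 ^ i)%nat /\ covers r (member t) T.
Proof.
  intros Hh Hr. induction i as [|i IH]; intros ax ay T HT.
  - destruct (classic (exists p, (p < n)%nat /\ T p)) as [(c & Hc & HTc)|Hno].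
    + exists [c]. split; [simpl; lia|]. intros p Hp HTp. exists c.
      split; [exact Hc|]. split; [now left|].
      destruct (HT c Hc HTc) as [X1 Y1]. destruct (HT p Hp HTp) as [X2 Y2].
      simpl in *. unfold near, sqd. subst r.
      assert (A : -h <= px c - px p <= h) by lra.
      assert (B : -h <= py c - py p <= h) by lra. nra.
    + exists []. split; [simpl; lia|]. intros p Hp HTp. elim Hno. now exists p.
  - set (m := 2 ^ i * h) in *.
    assert (Em : 2 ^ S i * h = 2 * m) by (unfold m; simpl; ring).
    destruct (IH ax ay (fun p => T p /\ px p <= ax + m /\ py p <= ay + m)) as (t1 & L1 & C1).
    { intros p Hp (HTp & A & B). destruct (HT p Hp HTp). fold m. lra. }
    destruct (IH ax (ay + m) (fun p => T p /\ px p <= ax + m /\ ay + m <= py p)) as (t2 & L2 & C2).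
    { intros p Hp (HTp & A & B). destruct (HT p Hp HTp). fold m. lra. }
    destruct (IH (ax + m) ay (fun p => T p /\ ax + m <= px p /\ py p <= ay + m)) as (t3 & L3 & C3).
    { intros p Hp (HTp & A & B). destruct (HT p Hp HTp). fold m. lra. }
    destruct (IH (ax + m) (ay + m) (fun p => T p /\ ax + m <= px p /\ ay + m <= py p)) as (t4 & L4 & C4).
    { intros p Hp (HTp & A & B). destruct (HT p Hp HTp). fold m. lra. }
    exists (t1 ++ t2 ++ t3 ++ t4). split.
    { rewrite !length_app, Nat.pow_succ_r'. lia. }
    intros p Hp HTp.
    assert (Hsub : forall (t : list nat) (T' : nat -> Prop), covers r (member t) T' -> T' p ->
               incl t (t1 ++ t2 ++ t3 ++ t4) ->
               exists c, (c < n)%nat /\ member (t1 ++ t2 ++ t3 ++ t4) c /\ near r c p).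
    { intros t T' HC HT' Hi. destruct (HC p Hp HT') as (c & Hc & Hm & Hn).
      exists c. split; [exact Hc|]. split; [now apply Hi|exact Hn]. }
    destruct (Rle_dec (px p) (ax + m)); destruct (Rle_dec (py p) (ay + m)).
    + apply (Hsub _ _ C1); [tauto|]. intros c Hc. rewrite !in_app_iff. tauto.
    + apply (Hsub _ _ C2); [split; [exact HTp|]; lra|]. intros c Hc. rewrite !in_app_iff. tauto.
    + apply (Hsub _ _ C3); [split; [exact HTp|]; lra|]. intros c Hc. rewrite !in_app_iff. tauto.
    + apply (Hsub _ _ C4); [split; [exact HTp|]; lra|]. intros c Hc. rewrite !in_app_iff. tauto.
Qed.

(** The ball lies in a square of side [4 * 2^i * r], which is [2^(i + 3)] times [r / 2]. For a fixed
    ratio of ball to disk the optimum is thus bounded, and so is the depth of the brute-force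
    search. *)
Lemma packing_ball r i v (T : nat -> Prop) : 0 <= r ->
  (forall p, (p < n)%nat -> T p -> near (2 * 2 ^ i * r) v p) ->
  exists t, (length t <= 4 ^ (i + 3))%nat /\ covers r (member t) T.
Proof.
  intros Hr HT. set (L := 2 * 2 ^ i * r) in *.
  assert (HL : 0 <= L).
  { unfold L. assert (0 < 2 ^ i) by (apply pow_lt; lra). nra. }
  assert (EL : 2 ^ (i + 3) * (r / 2) = 2 * L) by (unfold L; rewrite pow_add; simpl; field).
  apply (packing_square r (r / 2)) with (ax := px v - L) (ay := py v - L); [lra|field|].
  intros p Hp HTp. specialize (HT p Hp HTp). unfold near, sqd in HT. rewrite EL.
  set (a := px v - px p) in *. set (b := py v - py p) in *.
  assert (A : -L <= a <= L) by nra. assert (B : -L <= b <= L) by nra.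
  unfold a, b in *. lra.
Qed.

(** Classical choice of sublists is confined to the analysis: it is applied to a hypothetical cover
    that the program never computes. *)
Definition asb (Q : Prop) : bool := if excluded_middle_informative Q then true else false.

Lemma asb_true Q : asb Q = true <-> Q.
Proof. unfold asb. destruct (excluded_middle_informative Q); split; auto; discriminate. Qed.

Lemma filter_length_disjoint {A : Type} (f g h : A -> bool) (l : list A) :
  (forall x, f x = true -> h x = true) -> (forall x, g x = true -> h x = true) ->
  (forall x, f x = true -> g x = true -> False) ->
  (length (filter f l) + length (filter g l) <= length (filter h l))%nat.
Proof.
  intros Hf Hg Hd. induction l as [|x l IH]; simpl; [lia|].
  specialize (Hf x); specialize (Hg x); specialize (Hd x).
  destruct (f x), (g x), (h x); simpl; try lia; exfalso;
    try (discriminate (Hf eq_refl)); try (discriminate (Hg eq_refl)); auto.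
Qed.

Definition touches (r : R) (U : nat -> Prop) (c : nat) : Prop :=
  exists p, (p < n)%nat /\ U p /\ near r c p.

(* Members of the cover [C] whose disk misses [U]; these have been charged for. *)
Definition dead (r : R) (U : nat -> Prop) (C : list nat) : nat :=
  length (filter (fun c => asb (~ touches r U c)) C).

(* The disks meeting the inner ball stay clear of everything outside the ball
   enlarged by [2 * r], so they are charged only once. *)
Lemma dead_step r R v (U U' : nat -> Prop) C :
  0 <= r -> 0 <= R ->
  (forall p, (p < n)%nat -> U' p -> U p /\ ~ near (R + 2 * r) v p) ->
  covers r (member C) (fun _ => True) ->
  exists t, covers r (member t) (fun p => U p /\ near R v p) /\
    (dead r U C + length t <= dead r U' C)%nat.
Proof.
  intros Hr HR HU HC. set (S := fun p => U p /\ near R v p).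
  exists (filter (fun c => asb (touches r S c)) C). split.
  - intros p Hp HS. destruct (HC p Hp I) as (c & Hc & Hin & Hn).
    exists c. split; [exact Hc|]. split; [|exact Hn].
    apply filter_In. split; [exact Hin|]. apply asb_true. now exists p.
  - apply filter_length_disjoint; intros c.
    + rewrite !asb_true. intros H (p & Hp & Hu & Hn). apply H.
      exists p. destruct (HU p Hp Hu). auto.
    + rewrite !asb_true. intros (s & Hs & (_ & Hsv) & Hns) (p & Hp & Hu & Hn).
      destruct (HU p Hp Hu) as [_ Hfar]. apply Hfar.
      replace (R + 2 * r) with (R + (r + r)) by ring.
      apply (near_trans R (r + r) v s p); [lra|lra|exact Hsv|].
      apply (near_trans r r s c p); [lra|lra|now apply near_sym|exact Hn].
    + rewrite !asb_true. intros H (s & Hs & (Hu & _) & Hn). apply H. now exists s.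
Qed.

End Geometry.

(** * Frame rules *)

Fixpoint writes (c : com) (A : nat) : bool :=
  match c with
  | Put B _ _ => Nat.eqb A B
  | Seq c1 c2 | IfLe _ _ c1 c2 => writes c1 A || writes c2 A
  | For _ c => writes c A
  | _ => false
  end.

Fixpoint emits (c : com) : bool :=
  match c with
  | Emit _ | EmitNone => true
  | Seq c1 c2 | IfLe _ _ c1 c2 => emits c1 || emits c2
  | For _ c => emits c
  | _ => false
  end.

Lemma sem_frame n c A : forall env s,
  writes c A = false -> arr (sem n c env s) A = arr s A.
Proof.
  induction c as [|B i e|c1 IH1 c2 IH2|e1 e2 c1 IH1 c2 IH2|a c IH|a|];
    intros env s Hw; simpl in Hw; try apply orb_false_iff in Hw as [Hw1 Hw2];
    cbn [sem arr].
  - reflexivity.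
  - unfold upd_arr. now rewrite Hw.
  - now rewrite IH2, IH1.
  - destruct Rle_dec; auto.
  - generalize n at 1. induction n0 as [|m IHm]; [reflexivity|].
    cbn [loop]. now rewrite IH.
  - reflexivity.
  - reflexivity.
Qed.

Lemma sem_out n c : forall env s, emits c = false -> out (sem n c env s) = out s.
Proof.
  induction c as [|B i e|c1 IH1 c2 IH2|e1 e2 c1 IH1 c2 IH2|a c IH|a|];
    intros env s Hw; simpl in Hw; try apply orb_false_iff in Hw as [Hw1 Hw2];
    cbn [sem out]; try discriminate; try reflexivity.
  - now rewrite IH2, IH1.
  - destruct Rle_dec; auto.
  - generalize n at 1. induction n0 as [|m IHm]; [reflexivity|].
    cbn [loop]. now rewrite IH.
Qed.

(** The frame facts compare the current state with the one before the loop, so an invariant need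
    only speak of what the body changes. *)
Lemma for_ind n a c env s (I : nat -> store -> Prop) :
  I 0%nat s ->
  (forall i s', (i < n)%nat ->
     (forall A, writes c A = false -> arr s' A = arr s A) ->
     (emits c = false -> out s' = out s) ->
     I i s' -> I (S i) (sem n c (updN env a i) s')) ->
  I n (sem n (For a c) env s).
Proof.
  intros H0 HS. cbn [sem].
  set (f := fun (i : nat) (s0 : store) => sem n c (updN env a i) s0).
  assert (H : forall m, (m <= n)%nat ->
     (forall A, writes c A = false -> arr (loop m f s) A = arr s A) /\
     (emits c = false -> out (loop m f s) = out s) /\ I m (loop m f s)).
  { induction m as [|m IH]; intros Hm; [auto|].
    destruct IH as (F & O & HI); [lia|]. cbn [loop]. split; [|split].
    - intros A HA. unfold f at 1. rewrite sem_frame by exact HA. now apply F.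
    - intros HE. unfold f at 1. rewrite sem_out by exact HE. now apply O.
    - apply HS; auto; lia. }
  now apply (H n).
Qed.

Lemma updN_same env a i : updN env a i a = i.
Proof. unfold updN. now rewrite Nat.eqb_refl. Qed.

Lemma updN_other env a i b : b <> a -> updN env a i b = env b.
Proof. intros H. unfold updN. destruct (Nat.eqb_spec b a); congruence. Qed.

Lemma upd_arr_other m A k v B : B <> A -> upd_arr m A k v B = m B.
Proof. intros H. unfold upd_arr. destruct (Nat.eqb_spec B A); congruence. Qed.

Lemma upd_arr_same m A k v : upd_arr m A k v A k = v.
Proof. unfold upd_arr, updR. now rewrite !Nat.eqb_refl. Qed.

Lemma upd_arr_index m A k v j : j <> k -> upd_arr m A k v A j = m A j.
Proof.
  intros H. unfold upd_arr, updR. rewrite Nat.eqb_refl.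
  destruct (Nat.eqb_spec j k); congruence.
Qed.

(** * The program *)

(* Arrays: coordinates [aX], [aY]; sets of points [aREM] (not yet covered),
   [aCOV] (chosen centres), [aCUR], [aBST] (candidate and best cover in the
   search), [aTGT] (points to be covered), [aSRC] (sources, with times [aTIME]),
   [aBURN].  The others are scalars, stored at index 0. *)
Notation aX := 0%nat. Notation aY := 1%nat. Notation aREM := 2%nat.
Notation aCOV := 3%nat. Notation aCUR := 4%nat. Notation aBST := 5%nat.
Notation aTGT := 6%nat. Notation aSRC := 7%nat. Notation aTIME := 8%nat.
Notation aBURN := 9%nat. Notation vSUC := 10%nat. Notation vCNT := 12%nat.
Notation vPREV := 13%nat. Notation vBEST := 14%nat. Notation vACC := 15%nat.
Notation vOK := 16%nat. Notation vHIT := 17%nat. Notation vDONE := 18%nat.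
Notation vFOUND := 19%nat.

Definition cst (k : nat) : expr := EConst (Z.of_nat k).
Definition sc (A : nat) : expr := EGet A IZero.
Definition el (A a : nat) : expr := EGet A (IVar a).
Definition sq (e : expr) : expr := EMul e e.
Definition esqd (a b : nat) : expr :=
  EAdd (sq (ESub (el aX a) (el aX b))) (sq (ESub (el aY a) (el aY b))).
Definition If_on (e : expr) (c1 c2 : com) : com := IfLe (EConst 1) e c1 c2.

(* Loop variable 0 is the guessed radius throughout the covering phase. *)
Definition hit_loop (a : nat) : com :=
  For (S a) (If_on (el aCUR (S a))
    (IfLe (esqd (S a) a) (sq (EVar 0)) (Put vHIT IZero (cst 1)) Skip) Skip).

Definition check (a : nat) : com :=
  Seq (Put vOK IZero (cst 1))
    (For a (If_on (el aTGT a)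
      (Seq (Put vHIT IZero (cst 0))
        (Seq (hit_loop a) (If_on (sc vHIT) Skip (Put vOK IZero (cst 0))))) Skip)).

Definition record_best (j a : nat) : com :=
  If_on (sc vOK)
    (IfLe (sc vBEST) (cst j) Skip
      (Seq (Put vBEST IZero (cst j)) (For a (Put aBST (IVar a) (el aCUR a))))) Skip.

(* Tries all extensions of the [j]-element set [aCUR] by at most [d] points. *)
Fixpoint search (d j a : nat) : com :=
  Seq (Seq (check a) (record_best j a))
    match d with
    | O => Skip
    | S d' =>
        For a (If_on (el aCUR a) Skip
          (Seq (Put aCUR (IVar a) (cst 1))
            (Seq (search d' (S j) (S a)) (Put aCUR (IVar a) (cst 0)))))
    end.

Definition set_target (k : nat) : com :=
  For 2 (Seq (Put aCUR (IVar 2) (cst 0))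
    (If_on (el aREM 2)
      (IfLe (esqd 1 2) (sq (EMul (cst (2 * k)) (EVar 0)))
        (Put aTGT (IVar 2) (cst 1)) (Put aTGT (IVar 2) (cst 0)))
      (Put aTGT (IVar 2) (cst 0)))).

Definition accept : com :=
  Seq (Put vACC IZero (cst 1))
    (Seq (Put vCNT IZero (EAdd (sc vCNT) (sc vBEST)))
      (For 2 (Seq (If_on (el aTGT 2) (Put aREM (IVar 2) (cst 0)) Skip)
        (If_on (el aBST 2) (Put aCOV (IVar 2) (cst 1)) Skip)))).

(** On entry [vPREV] holds [m_(k-1)], and the test is [m_k <= (1 + 1/q) m_(k-1)] without division.
    The value [S M] of [vBEST] stands for no cover found, and [vACC] replaces an exit from the
    sequence of radii. *)
Definition grow (q M k : nat) : com :=
  If_on (sc vACC) Skip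
    (Seq (set_target k)
      (Seq (Put vBEST IZero (cst (S M)))
        (Seq (search M 0 2)
          (IfLe (EMul (cst q) (sc vBEST)) (EMul (cst (S q)) (sc vPREV))
            accept (Put vPREV IZero (sc vBEST)))))).

(** Unrolled when the program is built, since the number of radii does not depend on the input. *)
Fixpoint grows (q M k : nat) : com :=
  match k with
  | O => Skip
  | S k' => Seq (grows q M k') (grow q M k)
  end.

(** The initial 1 in [vPREV] is [m_0]: at radius 0 only the place of [v] itself has to be
    covered. *)
Definition process (q M K : nat) : com :=
  Seq (Put vPREV IZero (cst 1)) (Seq (Put vACC IZero (cst 0)) (grows q M K)).

(** [vCNT] sums the sizes of the covers of all rounds; it bounds the number of centres in [aCOV],
    which different rounds may share. *)
Definition guess (q M K : nat) : com :=
  Seq (For 1 (Seq (Put aREM (IVar 1) (cst 1)) (Put aCOV (IVar 1) (cst 0))))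
    (Seq (Put vCNT IZero (cst 0))
      (Seq (For 1 (If_on (el aREM 1) (process q M K) Skip))
        (IfLe (EMul (cst q) (sc vCNT)) (EMul (cst (S q)) (EAdd (EVar 0) (cst 1)))
          (Put vSUC IZero (cst 1)) Skip))).

Definition cover_phase (q M K : nat) : com :=
  Seq (Put vSUC IZero (cst 0)) (For 0 (If_on (sc vSUC) Skip (guess q M K))).

Definition set_burnt : com :=
  For 1 (Seq (Put aBURN (IVar 1) (cst 0))
    (For 2 (If_on (el aSRC 2)
      (IfLe (esqd 2 1) (sq (ESub (EVar 0) (el aTIME 2)))
        (Put aBURN (IVar 1) (cst 1)) Skip) Skip))).

Definition select : com :=
  Seq (Put vFOUND IZero (cst 1))
    (Seq (Put aSRC (IVar 1) (cst 1)) (Seq (Put aTIME (IVar 1) (EVar 0)) (Emit 1))).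

Definition pick (g : expr) : com :=
  For 1 (If_on (el aBURN 1) Skip (If_on (sc vFOUND) Skip (If_on g select Skip))).

(** The guard of the second [pick] is constant, so it takes any unburnt point; [vFOUND] keeps it
    idle after a success of the first. *)
Definition burn_step : com :=
  Seq set_burnt
    (Seq (Put vFOUND IZero (cst 0))
      (Seq (pick (el aCOV 1)) (Seq (pick (cst 1))
        (If_on (sc vFOUND) Skip (Seq EmitNone (Put vDONE IZero (cst 1))))))).

(** Every schedule ends with a step without source: it is emitted inside the loop once no unburnt
    point is left, and after the loop if all [n] iterations have chosen one. *)
Definition burn_phase : com :=
  Seq (For 0 (Put aSRC (IVar 0) (cst 0)))
    (Seq (Put vDONE IZero (cst 0))
      (Seq (For 0 (If_on (sc vDONE) Skip burn_step))
        (If_on (sc vDONE) Skip EmitNone))).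

Definition burning_program (q M K : nat) : com :=
  Seq (cover_phase q M K) burn_phase.

Lemma search_wf d : forall j k, (0 < k)%nat -> wf k (search d j k) = true.
Proof.
  induction d as [|d IH]; intros j k Hk; simpl;
    rewrite ?IH by lia; rewrite ?Nat.eqb_refl;
    repeat match goal with
    | |- context [Nat.ltb ?a ?b] =>
        replace (Nat.ltb a b) with true by (symmetry; apply Nat.ltb_lt; lia)
    end; reflexivity.
Qed.

Lemma burning_program_wf q M K : wf 0 (burning_program q M K) = true.
Proof.
  assert (Hg : forall k, wf 2 (grows q M k) = true).
  { induction k as [|k IH]; [reflexivity|]. cbn [grows wf]. rewrite IH.
    unfold grow, If_on. cbn [wf]. rewrite search_wf by lia. reflexivity. }
  unfold burning_program, cover_phase, guess, process, If_on. cbn [wf].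
  rewrite Hg. reflexivity.
Qed.

Lemma search_writes d : forall j a A,
  ~ In A [aCUR; aBST; vBEST; vOK; vHIT] -> writes (search d j a) A = false.
Proof.
  induction d as [|d IH]; intros j a A HA; cbn [search];
    unfold check, record_best, hit_loop, If_on; cbn [writes];
    try rewrite IH by exact HA; simpl in HA;
    repeat match goal with
    | |- context [Nat.eqb A ?B] => destruct (Nat.eqb_spec A B); [subst; tauto|]
    end; reflexivity.
Qed.

Lemma search_emits d : forall j a, emits (search d j a) = false.
Proof. induction d as [|d IH]; intros j a; simpl; rewrite ?IH; reflexivity. Qed.

Lemma eval_cst env m k : eval env m (cst k) = INR k.
Proof. simpl. now rewrite INR_IZR_INZ. Qed.

(** * The brute-force search *)

Definition on (s : store) (A i : nat) : Prop := 1 <= arr s A i.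

Section Cover.

Variable n : nat.
Variables px py : nat -> R.

Definition holds_points (s : store) : Prop := arr s aX = px /\ arr s aY = py.

Notation near := (near px py).
Notation covers := (covers n px py).

Lemma eval_esqd s env a b : holds_points s ->
  eval env (arr s) (esqd a b) = sqd px py (env a) (env b).
Proof. intros [HX HY]. cbn. now rewrite HX, HY. Qed.

Lemma hit_loop_spec a env s : (0 < a)%nat -> holds_points s ->
  (on (sem n (hit_loop a) env s) vHIT 0 <->
   on s vHIT 0 \/ exists c, (c < n)%nat /\ on s aCUR c /\ near (INR (env 0%nat)) c (env a)).
Proof.
  intros Ha Hs. unfold hit_loop.
  apply (for_ind n (S a) _ env s (fun i s' => on s' vHIT 0 <-> on s vHIT 0 \/
    exists c, (c < i)%nat /\ on s aCUR c /\ near (INR (env 0%nat)) c (env a))).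
  { split; [tauto|]. intros [H|(c & Hc & _)]; [exact H|lia]. }
  intros i s' Hi F _ IH. unfold If_on. cbn [sem].
  assert (HC : arr s' aCUR = arr s aCUR) by now apply F.
  assert (Hs' : holds_points s') by (split; rewrite F by reflexivity; apply Hs).
  assert (Hev : eval (updN env (S a) i) (arr s') (sq (EVar 0)) = INR (env 0%nat) * INR (env 0%nat)).
  { cbn [eval sq]. rewrite updN_other by lia. reflexivity. }
  rewrite eval_esqd, Hev by exact Hs'. rewrite updN_same, updN_other by lia.
  cbn [eval el idx_val]. rewrite updN_same, HC.
  destruct (Rle_dec 1 (arr s aCUR i)) as [Hon|Hoff].
  - destruct (Rle_dec _ _) as [Hn|Hn].
    + split; [|intros _; unfold on; cbn [arr sem]; rewrite upd_arr_same, eval_cst; simpl; lra].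
      intros _. right. exists i. split; [lia|]. now split.
    + rewrite IH. split; (intros [H|(c & Hc & H1 & H2)]; [now left|right]).
      * exists c. split; [lia|now split].
      * exists c. split; [|now split].
        destruct (Nat.eq_dec c i); [subst; contradiction|lia].
  - rewrite IH. split; (intros [H|(c & Hc & H1 & H2)]; [now left|right]).
    * exists c. split; [lia|now split].
    * exists c. split; [|now split].
      destruct (Nat.eq_dec c i); [subst; contradiction|lia].
Qed.

Lemma check_spec a env s : (0 < a)%nat -> holds_points s ->
  (on (sem n (check a) env s) vOK 0 <-> covers (INR (env 0%nat)) (on s aCUR) (on s aTGT)).
Proof.
  intros Ha Hs. unfold check. cbn [sem]. set (s1 := Store _ _).
  assert (F1 : forall A, A <> vOK -> arr s1 A = arr s A)
    by (intros A HA; cbn [arr s1]; now rewrite upd_arr_other).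
  assert (O1 : on s1 vOK 0)
    by (unfold on; cbn [arr s1 idx_val]; rewrite upd_arr_same, eval_cst; simpl; lra).
  pose (I := fun (i : nat) s' => on s' vOK 0 <->
    forall p, (p < i)%nat -> on s aTGT p ->
      exists c, (c < n)%nat /\ on s aCUR c /\ near (INR (env 0%nat)) c p).
  match goal with |- on (loop n _ s1) _ _ <-> _ =>
    change (I n (sem n (For a (If_on (el aTGT a)
      (Seq (Put vHIT IZero (cst 0))
        (Seq (hit_loop a) (If_on (sc vHIT) Skip (Put vOK IZero (cst 0))))) Skip)) env s1)) end.
  apply for_ind; unfold I; clear I.
  { split; [intros _ p Hp; lia|intros _; exact O1]. }
  intros i s' Hi F _ IH.
  assert (HC : arr s' aCUR = arr s aCUR) by (rewrite F, F1 by (reflexivity || lia); reflexivity).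
  assert (HT : arr s' aTGT = arr s aTGT) by (rewrite F, F1 by (reflexivity || lia); reflexivity).
  assert (Hs' : holds_points s')
    by (split; rewrite F, F1 by (reflexivity || lia); apply Hs).
  unfold If_on. cbn [sem]. cbn [eval el idx_val]. rewrite updN_same, HT.
  destruct (Rle_dec 1 (arr s aTGT i)) as [Hon|Hoff].
  - set (s2 := Store (upd_arr (arr s') vHIT 0 _) _).
    assert (F2 : forall A, A <> vHIT -> arr s2 A = arr s' A)
      by (intros A HA; cbn [arr s2]; now rewrite upd_arr_other).
    assert (Hs2 : holds_points s2) by (split; rewrite F2 by lia; apply Hs').
    pose proof (hit_loop_spec a (updN env a i) s2 Ha Hs2) as HH.
    rewrite updN_same, updN_other in HH by lia.
    assert (O2 : ~ on s2 vHIT 0).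
    { unfold on; cbn [arr s2]. rewrite upd_arr_same, eval_cst. simpl. lra. }
    assert (HC2 : arr s2 aCUR = arr s aCUR) by (rewrite F2 by lia; exact HC).
    assert (HO : arr (sem n (hit_loop a) (updN env a i) s2) vOK = arr s' vOK).
    { rewrite sem_frame by reflexivity. apply F2. lia. }
    unfold sc. cbn [eval idx_val].
    destruct (Rle_dec 1 (arr (sem n (hit_loop a) (updN env a i) s2) vHIT 0%nat)) as [Hh|Hh].
    + unfold on at 1. rewrite HO. fold (on s' vOK 0). rewrite IH.
      apply HH in Hh. destruct Hh as [Hh|(c & Hc & Hcur & Hnear)]; [contradiction|].
      unfold on in Hcur; rewrite HC2 in Hcur.
      split; intros H p Hp HTp.
      * destruct (Nat.eq_dec p i) as [->|]; [now exists c|]. apply H; [lia|exact HTp].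
      * apply H; [lia|exact HTp].
    + split.
      * unfold on; cbn [arr]. rewrite upd_arr_same, eval_cst. simpl. lra.
      * intros H. elim Hh. apply HH. right. destruct (H i (Nat.lt_succ_diag_r i) Hon) as (c & Hc & Hcur & Hn).
        exists c. unfold on; rewrite HC2. now repeat split.
  - rewrite IH. split; intros H p Hp HTp.
    + destruct (Nat.eq_dec p i) as [->|]; [contradiction|]. apply H; [lia|exact HTp].
    + apply H; [lia|exact HTp].
Qed.

(** A cardinality bound with a real [m], since the counters are real cells. A list with repetitions
    will do, so covers of several rounds are simply concatenated. *)
Definition bounded_by (C : nat -> Prop) (m : R) : Prop :=
  exists l, INR (length l) <= m /\ forall c, (c < n)%nat -> C c -> In c l.

(** The premise excludes the initial value [S M], for which [aBST] is still arbitrary. *)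
Definition best_ok (M : nat) (r : R) (s : store) : Prop :=
  arr s vBEST 0%nat <= INR M ->
  bounded_by (on s aBST) (arr s vBEST 0%nat) /\ covers r (on s aBST) (on s aTGT).

Lemma record_best_spec M j a env s : (0 < a)%nat ->
  let r := INR (env 0%nat) in
  let s' := sem n (record_best j a) env s in
  (on s vOK 0 -> covers r (on s aCUR) (on s aTGT)) ->
  bounded_by (on s aCUR) (INR j) ->
  arr s' vBEST 0%nat <= arr s vBEST 0%nat /\
  (best_ok M r s -> best_ok M r s') /\
  (on s vOK 0 -> arr s' vBEST 0%nat <= INR j).
Proof.
  intros Ha r s' Hok Hb. unfold s', record_best, If_on, sc. cbn [sem]. rewrite eval_cst.
  cbn [eval idx_val].
  destruct (Rle_dec 1 (arr s vOK 0%nat)) as [Hon|Hoff];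
    [|split; [lra|split; [auto|intros H; contradiction]]].
  destruct (Rle_dec (arr s vBEST 0%nat) (INR j)) as [Hle|Hgt];
    [split; [lra|split; [auto|auto]]|].
  set (s1 := Store _ _).
  change (loop n _ s1) with (sem n (For a (Put aBST (IVar a) (el aCUR a))) env s1).
  set (s2 := sem n _ env s1).
  assert (B2 : arr s2 vBEST 0%nat = INR j).
  { unfold s2. rewrite sem_frame by reflexivity. cbn [arr s1].
    now rewrite upd_arr_same. }
  assert (T2 : arr s2 aTGT = arr s aTGT).
  { unfold s2. rewrite sem_frame by reflexivity. cbn [arr s1].
    now rewrite upd_arr_other by lia. }
  assert (S2 : forall c, (c < n)%nat -> arr s2 aBST c = arr s aCUR c).
  { unfold s2. apply (for_ind n a _ env s1 (fun i s' => forall c, (c < i)%nat ->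
      arr s' aBST c = arr s aCUR c)); [intros; lia|].
    intros i s3 Hi F _ IH c Hc. cbn [sem arr eval el idx_val].
    rewrite updN_same. destruct (Nat.eq_dec c i) as [->|Hne].
    - rewrite upd_arr_same, F by reflexivity. cbn [arr s1]. now rewrite upd_arr_other by lia.
    - rewrite upd_arr_index by exact Hne. apply IH. lia. }
  split; [lra|split; [|lra]]. intros _ _. split.
  - rewrite B2. destruct Hb as (l & Hl & Hin). exists l. split; [exact Hl|].
    intros c Hc Hon'. apply Hin; [exact Hc|]. unfold on in *. now rewrite <- S2.
  - intros p Hp HT. unfold on in HT; rewrite T2 in HT.
    destruct (Hok Hon p Hp HT) as (c & Hc & Hcur & Hn).
    exists c. split; [exact Hc|]. split; [|exact Hn]. unfold on in *. now rewrite S2.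
Qed.

Lemma visit_spec M j a env s : (0 < a)%nat -> holds_points s ->
  let r := INR (env 0%nat) in
  let s' := sem n (Seq (check a) (record_best j a)) env s in
  bounded_by (on s aCUR) (INR j) ->
  (forall A, ~ In A [aBST; vBEST; vOK; vHIT] -> arr s' A = arr s A) /\
  arr s' vBEST 0%nat <= arr s vBEST 0%nat /\
  (best_ok M r s -> best_ok M r s') /\
  (covers r (on s aCUR) (on s aTGT) -> arr s' vBEST 0%nat <= INR j).
Proof.
  intros Ha Hs r s' Hb. unfold s'. cbn [sem].
  pose proof (check_spec a env s Ha Hs) as HK. fold r in HK.
  set (s1 := sem n (check a) env s) in *.
  assert (F1 : forall A, A <> vOK -> A <> vHIT -> arr s1 A = arr s A).
  { intros A h1 h2. unfold s1. apply sem_frame. cbn.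
    destruct (Nat.eqb_spec A 16); [contradiction|].
    destruct (Nat.eqb_spec A 17); [contradiction|]. reflexivity. }
  destruct (record_best_spec M j a env s1 Ha) as (RB1 & RB2 & RB3).
  { intros Hok. unfold on. rewrite !F1 by lia. now apply HK. }
  { unfold on. rewrite F1 by lia. exact Hb. }
  rewrite F1 in RB1 by lia. split; [|split; [exact RB1|split]].
  - intros A HA. simpl in HA. rewrite sem_frame; [apply F1; lia|]. cbn.
    destruct (Nat.eqb_spec A 5); [lia|]. destruct (Nat.eqb_spec A 14); [lia|]. reflexivity.
  - intros Hbo. apply RB2. unfold best_ok, on. rewrite !F1 by lia. exact Hbo.
  - intros HC. apply RB3, HK, HC.
Qed.

(** The two halves of optimality: [best_ok] says that the recorded size is attained, the last clause
    that no cover extending the current set by at most [d] points is smaller. [aCUR] is restored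
    only as a set, because a removed entry is reset to 0 and not to its former value. *)
Lemma search_spec M d : forall j a env s, (0 < a)%nat -> holds_points s ->
  let r := INR (env 0%nat) in
  let s' := sem n (search d j a) env s in
  bounded_by (on s aCUR) (INR j) ->
  (forall c, (c < n)%nat -> on s' aCUR c <-> on s aCUR c) /\
  arr s' vBEST 0%nat <= arr s vBEST 0%nat /\
  (best_ok M r s -> best_ok M r s') /\
  (forall t, (length t <= d)%nat ->
     covers r (fun c => on s aCUR c \/ In c t) (on s aTGT) ->
     arr s' vBEST 0%nat <= INR (j + length t)).
Proof.
  induction d as [|d IHd]; intros j a env s Ha Hs r s' Hb; unfold s'; clear s';
    destruct (visit_spec M j a env s Ha Hs Hb) as (F2 & Hle2 & Hbest2 & Hopt2);
    fold r in Hbest2, Hopt2; cbn [search];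
    set (visit := Seq (check a) (record_best j a)) in *; cbn [sem];
    set (s2 := sem n visit env s) in *.
  - split; [|split; [exact Hle2|split; [exact Hbest2|]]].
    + intros c Hc. unfold on. rewrite F2 by (simpl; lia). tauto.
    + intros t Ht HC. destruct t; [|simpl in Ht; lia]. rewrite Nat.add_0_r. apply Hopt2.
      intros p Hp HT. destruct (HC p Hp HT) as (c & Hc & [Hcur|[]] & Hn). now exists c.
  - set (body := Seq (Put aCUR (IVar a) (cst 1))
            (Seq (search d (S j) (S a)) (Put aCUR (IVar a) (cst 0)))).
    (* The last clause records progress: all extensions whose first new point is below [i] have been
       accounted for, the rest [t] being left to the recursive call. *)
    set (I := fun (i : nat) s' =>
      (forall c, (c < n)%nat -> on s' aCUR c <-> on s aCUR c) /\
      arr s' vBEST 0%nat <= arr s2 vBEST 0%nat /\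
      (best_ok M r s -> best_ok M r s') /\
      (forall x t, (x < i)%nat -> ~ on s aCUR x -> (length t <= d)%nat ->
         covers r (fun c => on s aCUR c \/ In c (x :: t)) (on s aTGT) ->
         arr s' vBEST 0%nat <= INR (j + length (x :: t)))).
    match goal with |- context [loop n ?f s2] =>
      change (loop n f s2) with (sem n (For a (If_on (el aCUR a) Skip body)) env s2) end.
    assert (HI : I n (sem n (For a (If_on (el aCUR a) Skip body)) env s2)).
    { apply for_ind; unfold I.
      { split; [|split; [lra|split; [exact Hbest2|intros; lia]]].
        intros c Hc. unfold on. rewrite F2 by (simpl; lia). tauto. }
      intros i s3 Hi F _ (I1 & I2 & I3 & I4).
      assert (HT3 : arr s3 aTGT = arr s aTGT).
      { rewrite F, F2; [reflexivity|simpl; lia|]. cbn [writes If_on body].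
        rewrite search_writes by (simpl; lia). reflexivity. }
      assert (Hs3 : holds_points s3).
      { split; (rewrite F, F2; [apply Hs|simpl; lia|]; cbn [writes If_on body];
          rewrite search_writes by (simpl; lia); reflexivity). }
      unfold If_on. cbn [sem eval el idx_val]. rewrite updN_same.
      destruct (Rle_dec 1 (arr s3 aCUR i)) as [Hon|Hoff].
      { split; [exact I1|split; [exact I2|split; [exact I3|]]].
        intros x t Hx Hnx. apply I4; [|exact Hnx].
        destruct (Nat.eq_dec x i); [subst x; elim Hnx; apply I1; [exact Hi|exact Hon]|lia]. }
      unfold body. cbn [sem idx_val]. rewrite !eval_cst, updN_same.
      set (s4 := Store (upd_arr (arr s3) aCUR i _) _).
      assert (F4 : forall A, A <> aCUR -> arr s4 A = arr s3 A)
        by (intros A HA; cbn [arr s4]; now rewrite upd_arr_other).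
      assert (C4 : forall c, on s4 aCUR c <-> c = i \/ on s3 aCUR c).
      { intros c. unfold on; cbn [arr s4]. destruct (Nat.eq_dec c i) as [->|Hne].
        - rewrite upd_arr_same. simpl. split; [auto|intros _; lra].
        - rewrite upd_arr_index by exact Hne. tauto. }
      assert (Hb4 : bounded_by (on s4 aCUR) (INR (S j))).
      { destruct Hb as (l & Hl & Hin). exists (i :: l). split.
        - cbn [length]. rewrite !S_INR. lra.
        - intros c Hc H. apply C4 in H as [->|H]; [now left|right].
          apply Hin; [exact Hc|]. now apply I1. }
      assert (Hs4 : holds_points s4) by (split; rewrite F4 by lia; apply Hs3).
      destruct (IHd (S j) (S a) (updN env a i) s4 ltac:(lia) Hs4 Hb4) as (J1 & J2 & J3 & J4).
      rewrite updN_other in J3, J4 by lia. fold r in J3, J4.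
      set (s5 := sem n (search d (S j) (S a)) (updN env a i) s4) in *.
      assert (T5 : arr s5 aTGT = arr s3 aTGT).
      { unfold s5. rewrite sem_frame by (apply search_writes; simpl; lia). apply F4. lia. }
      set (s6 := Store (upd_arr (arr s5) aCUR i _) _).
      assert (F6 : forall A, A <> aCUR -> arr s6 A = arr s5 A)
        by (intros A HA; cbn [arr s6]; now rewrite upd_arr_other).
      assert (B6 : arr s6 vBEST 0%nat <= arr s3 vBEST 0%nat).
      { rewrite F6 by lia. rewrite <- (F4 vBEST) by lia. exact J2. }
      split; [|split; [lra|split]].
      - intros c Hc. rewrite <- I1 by exact Hc. unfold on at 1; cbn [arr s6].
        destruct (Nat.eq_dec c i) as [->|Hne].
        + rewrite upd_arr_same. simpl. split; [lra|intros H; contradiction].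
        + rewrite upd_arr_index by exact Hne. fold (on s5 aCUR c). rewrite J1, C4 by exact Hc.
          intuition.
      - intros Hbo. assert (Hbo5 : best_ok M r s5).
        { apply J3. unfold best_ok, on. rewrite !F4 by lia. now apply I3. }
        unfold best_ok, on. rewrite !F6 by lia. exact Hbo5.
      - intros x t Hx Hnx Ht HC. destruct (Nat.eq_dec x i) as [->|Hne].
        + rewrite F6 by lia. replace (j + length (i :: t))%nat with (S j + length t)%nat by (simpl; lia).
          apply J4; [exact Ht|]. intros p Hp HTp.
          assert (HTp' : on s aTGT p) by (unfold on in *; rewrite F4, HT3 in HTp by lia; exact HTp).
          destruct (HC p Hp HTp') as (c & Hc & Hcc & Hn). exists c. split; [exact Hc|].
          split; [|exact Hn]. rewrite C4, I1 by exact Hc. simpl in Hcc.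
          destruct Hcc as [H|[H|H]]; auto.
        + eapply Rle_trans; [exact B6|]. apply I4; [lia|exact Hnx|exact Ht|exact HC]. }
    destruct HI as (I1 & I2 & I3 & I4).
    split; [exact I1|split; [lra|split; [exact I3|]]].
    induction t as [|x t IHt]; intros Ht HC.
    + eapply Rle_trans; [exact I2|]. rewrite Nat.add_0_r. apply Hopt2.
      intros p Hp HT. destruct (HC p Hp HT) as (c & Hc & [Hcur|[]] & Hn). now exists c.
    (* A listed point that is out of range or already chosen adds nothing to the cover and is
       dropped, which only improves the bound. *)
    + simpl in Ht. destruct (classic ((x < n)%nat /\ ~ on s aCUR x)) as [[Hx Hnx]|Hno].
      * apply I4; [exact Hx|exact Hnx|lia|exact HC].
      * eapply Rle_trans; [apply IHt; [lia|]|apply le_INR; simpl; lia].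
        intros p Hp HT. destruct (HC p Hp HT) as (c & Hc & Hcc & Hn).
        exists c. split; [exact Hc|]. split; [|exact Hn].
        destruct Hcc as [H|[<-|H]]; [now left| |now right].
        left. apply NNPP. intros Hnot. apply Hno. now split.
Qed.

End Cover.

Section Phase.

Variable n : nat.
Variables px py : nat -> R.

Notation near := (near px py).
Notation covers := (covers n px py).
Notation holds_points := (holds_points px py).
Notation bounded_by := (bounded_by n).
Notation best_ok := (best_ok n px py).

(** * Covering with a guessed radius *)

Lemma set_target_spec k env s : holds_points s ->
  let s' := sem n (set_target k) env s in
  forall p, (p < n)%nat -> ~ on s' aCUR p /\
    (on s' aTGT p <-> on s aREM p /\ near (INR (2 * k) * INR (env 0%nat)) (env 1%nat) p).
Proof.
  intros Hs s'. unfold s', set_target.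
  apply (for_ind n 2 _ env s (fun i s' => forall p, (p < i)%nat -> ~ on s' aCUR p /\
    (on s' aTGT p <-> on s aREM p /\ near (INR (2 * k) * INR (env 0%nat)) (env 1%nat) p)));
    [intros; lia|].
  intros i s1 Hi F _ IH p Hp.
  assert (HR : arr s1 aREM = arr s aREM) by now apply F.
  assert (Hs1 : holds_points s1) by (split; rewrite F by reflexivity; apply Hs).
  unfold If_on. cbn [sem idx_val]. rewrite updN_same.
  set (s2 := Store _ _).
  assert (F2 : forall A, A <> aCUR -> arr s2 A = arr s1 A)
    by (intros A HA; cbn [arr s2]; now rewrite upd_arr_other).
  assert (Hs2 : holds_points s2) by (split; rewrite F2 by lia; apply Hs1).
  assert (C2 : arr s2 aCUR i = 0) by (cbn [arr s2]; now rewrite upd_arr_same, eval_cst).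
  assert (C2' : forall c, c <> i -> arr s2 aCUR c = arr s1 aCUR c)
    by (intros c Hc; cbn [arr s2]; now rewrite upd_arr_index).
  rewrite (eval_esqd px py) by exact Hs2. rewrite updN_same, updN_other by lia.
  replace (eval (updN env 2 i) (arr s2) (sq (EMul (cst (2 * k)) (EVar 0))))
    with ((INR (2 * k) * INR (env 0%nat)) * (INR (2 * k) * INR (env 0%nat))).
  2:{ cbn [sq eval]. rewrite eval_cst, updN_other by lia. reflexivity. }
  cbn [eval el idx_val]. rewrite updN_same, F2, HR by lia. rewrite !eval_cst.
  assert (Hput : forall b : nat,
    let s3 := Store (upd_arr (arr s2) aTGT i (INR b)) (out s2) in
    (1 <= INR b <-> on s aREM i /\ near (INR (2 * k) * INR (env 0%nat)) (env 1%nat) i) ->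
    ~ on s3 aCUR p /\
    (on s3 aTGT p <-> on s aREM p /\ near (INR (2 * k) * INR (env 0%nat)) (env 1%nat) p)).
  { intros b s3 Hb. destruct (Nat.eq_dec p i) as [->|Hne].
    - unfold on at 1 2; cbn [arr s3]. rewrite upd_arr_same, upd_arr_other, C2 by lia.
      split; [lra|exact Hb].
    - unfold on at 1 2; cbn [arr s3].
      rewrite upd_arr_index, upd_arr_other, C2', F2 by lia. apply IH. lia. }
  destruct (Rle_dec 1 (arr s aREM i)) as [Hon|Hoff].
  - destruct (Rle_dec _ _) as [Hn|Hn]; apply Hput; simpl.
    + split; [intros _; now split|lra].
    + split; [lra|intros [_ H]; contradiction].
  - apply Hput; simpl. split; [lra|intros [H _]; contradiction].
Qed.

Lemma accept_spec env s :
  let s' := sem n accept env s in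
  on s' vACC 0 /\ arr s' vCNT 0%nat = arr s vCNT 0%nat + arr s vBEST 0%nat /\
  (forall p, (p < n)%nat -> on s' aREM p <-> on s aREM p /\ ~ on s aTGT p) /\
  (forall p, (p < n)%nat -> on s' aCOV p <-> on s aCOV p \/ on s aBST p).
Proof.
  intros s'. unfold s', accept.
  set (body := Seq (If_on (el aTGT 2) (Put aREM (IVar 2) (cst 0)) Skip)
        (If_on (el aBST 2) (Put aCOV (IVar 2) (cst 1)) Skip)).
  cbn [sem]. set (s1 := Store (upd_arr (arr s) _ _ _) _). set (s2 := Store (upd_arr (arr s1) _ _ _) _).
  change (loop n _ s2) with (sem n (For 2 body) env s2).
  assert (F2 : forall A, A <> vACC -> A <> vCNT -> arr s2 A = arr s A)
    by (intros A h1 h2; cbn [arr s2 s1]; now rewrite !upd_arr_other).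
  split; [|split; [|]].
  - unfold on. rewrite sem_frame by reflexivity. cbn [arr s2 s1 idx_val].
    rewrite upd_arr_other, upd_arr_same, eval_cst by lia. simpl; lra.
  - rewrite sem_frame by reflexivity. cbn [arr s2 s1 idx_val].
    rewrite upd_arr_same. cbn [eval sc idx_val]. rewrite !upd_arr_other by lia. reflexivity.
  - set (I := fun (i : nat) s' =>
      (forall p, (p < n)%nat -> on s' aREM p <-> on s aREM p /\ ((p < i)%nat -> ~ on s aTGT p)) /\
      (forall p, (p < n)%nat -> on s' aCOV p <-> on s aCOV p \/ ((p < i)%nat /\ on s aBST p))).
    assert (H : I n (sem n (For 2 body) env s2)).
    { apply for_ind; unfold I; clear I.
      - unfold on. rewrite !F2 by lia. split; intros p Hp; split; try tauto.
        + intros H; split; [exact H|lia].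
        + intros [H|[H _]]; [exact H|lia].
      - intros i s3 Hi F _ [IR IC].
        assert (T3 : arr s3 aTGT = arr s aTGT) by (rewrite F, F2 by (reflexivity || lia); reflexivity).
        assert (B3 : arr s3 aBST = arr s aBST) by (rewrite F, F2 by (reflexivity || lia); reflexivity).
        unfold body, If_on. cbn [sem eval el idx_val]. rewrite !updN_same, !eval_cst, T3.
        set (s4 := if Rle_dec 1 (arr s aTGT i) then _ else s3).
        assert (F4 : forall A, A <> aREM -> arr s4 A = arr s3 A).
        { intros A HA. unfold s4. destruct Rle_dec; [|reflexivity]. cbn [arr].
          now rewrite upd_arr_other. }
        rewrite F4, B3 by lia.
        set (s5 := if Rle_dec 1 (arr s aBST i) then _ else s4).
        assert (R5 : arr s5 aREM = arr s4 aREM).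
        { unfold s5. destruct (Rle_dec 1 (arr s aBST i)); [|reflexivity].
          cbn [arr]. now rewrite upd_arr_other by lia. }
        split; intros p Hp.
        + unfold on at 1. rewrite R5. unfold s4.
          destruct (Rle_dec 1 (arr s aTGT i)) as [Ht|Ht]; cbn [arr].
          * destruct (Nat.eq_dec p i) as [->|Hne].
            -- rewrite upd_arr_same. simpl. split; [lra|]. intros [_ H]. elim H; [lia|exact Ht].
            -- rewrite upd_arr_index by exact Hne. fold (on s3 aREM p). rewrite IR by exact Hp.
               split; intros [H1 H2]; split; try exact H1; intros H3; apply H2; lia.
          * fold (on s3 aREM p). rewrite IR by exact Hp.
            split; intros [H1 H2]; split; try exact H1; intros H3.
            -- destruct (Nat.eq_dec p i) as [->|Hne]; [exact Ht|apply H2; lia].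
            -- apply H2; lia.
        + unfold s5. destruct (Rle_dec 1 (arr s aBST i)) as [Ht|Ht].
          * unfold on at 1; cbn [arr]. destruct (Nat.eq_dec p i) as [->|Hne].
            -- rewrite upd_arr_same. simpl. split; [|lra]. intros _. right. split; [lia|exact Ht].
            -- rewrite upd_arr_index, F4 by lia. fold (on s3 aCOV p). rewrite IC by exact Hp.
               split; (intros [H|[H1 H2]]; [now left|right; split; [lia|exact H2]]).
          * unfold on at 1. rewrite F4 by lia. fold (on s3 aCOV p). rewrite IC by exact Hp.
            split; (intros [H|[H1 H2]]; [now left|right; split; [|exact H2]]); [lia|].
            destruct (Nat.eq_dec p i) as [->|Hne]; [contradiction|lia]. }
    destruct H as [HR HC]. split; intros p Hp.
    + rewrite HR by exact Hp. intuition.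
    + rewrite HC by exact Hp. intuition.
Qed.

(** * Rounds of ball growing, and the search for the radius *)

Section Rounds.

Variables q lg : nat.
Let M := (4 ^ (lg + 3))%nat.
Let K := (2 ^ lg)%nat.
Hypothesis Hgrowth : (M * q ^ K < (q + 1) ^ K)%nat.

(** What a round hands to the charging argument: the ball of radius [rad + 2 * r] is removed and
    covered by [B], at a price [m] of at most [1 + 1/q] times any cover of the ball of radius [rad].
    The gap [2 * r] is the one in [dead_step]. *)
Definition accepted (r : R) (v : nat) (s s' : store) : Prop :=
  exists rad m (B : nat -> Prop), 0 <= rad /\
    (forall p, (p < n)%nat -> on s' aREM p <-> on s aREM p /\ ~ near (rad + 2 * r) v p) /\
    (forall p, (p < n)%nat -> on s' aCOV p <-> on s aCOV p \/ B p) /\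
    arr s' vCNT 0%nat = arr s vCNT 0%nat + m /\
    bounded_by B m /\
    covers r B (fun p => on s aREM p /\ near (rad + 2 * r) v p) /\
    (forall t, covers r (member t) (fun p => on s aREM p /\ near rad v p) ->
       INR q * m <= INR (S q) * INR (length t)).

(** After [k] rejected radii [vPREV] has grown by a factor above [1 + 1/q] each time, yet it is
    still at most [M]. For [k = K] this contradicts [Hgrowth]. *)
Definition pending (r : R) (v k : nat) (s s' : store) : Prop :=
  ~ on s' vACC 0 /\
  arr s' aREM = arr s aREM /\ arr s' aCOV = arr s aCOV /\ arr s' vCNT = arr s vCNT /\
  INR (q + 1) ^ k <= INR q ^ k * arr s' vPREV 0%nat /\
  arr s' vPREV 0%nat <= INR M /\
  (forall t, covers r (member t) (fun p => on s aREM p /\ near (INR (2 * k) * r) v p) ->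
     arr s' vPREV 0%nat <= INR (length t)).

Lemma grow_spec k env s s1 : (k < K)%nat -> holds_points s1 ->
  let r := INR (env 0%nat) in let v := env 1%nat in
  pending r v k s s1 ->
  let s' := sem n (grow q M (S k)) env s1 in
  (on s' vACC 0 /\ accepted r v s s') \/ pending r v (S k) s s'.
Proof.
  intros Hk Hs1 r v (P1 & P2 & P3 & P4 & P5 & P6 & P7) s'.
  unfold s', grow, If_on, sc. cbn [sem eval idx_val].
  destruct (Rle_dec 1 (arr s1 vACC 0%nat)) as [Hon|_]; [contradiction|].
  pose proof (set_target_spec (S k) env s1 Hs1) as HT. cbv zeta in HT. fold r in HT. fold v in HT.
  set (s2 := sem n (set_target (S k)) env s1) in *.
  assert (F2 : forall A, A <> aCUR -> A <> aTGT -> arr s2 A = arr s1 A).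
  { intros A h1 h2. unfold s2. apply sem_frame. cbn.
    destruct (Nat.eqb_spec A 4); [contradiction|].
    destruct (Nat.eqb_spec A 6); [contradiction|]. reflexivity. }
  set (s3 := Store _ _).
  assert (F3 : forall A, A <> vBEST -> arr s3 A = arr s2 A)
    by (intros A h1; cbn [arr s3]; now rewrite upd_arr_other).
  assert (B3 : arr s3 vBEST 0%nat = INR (S M)) by (cbn [arr s3]; now rewrite upd_arr_same, eval_cst).
  assert (Hs3 : holds_points s3) by (split; rewrite F3, F2 by lia; apply Hs1).
  assert (Hr : 0 <= r) by apply pos_INR.
  assert (Hb3 : bounded_by (on s3 aCUR) (INR 0)).
  { exists []. split; [simpl; lra|]. intros c Hc H. destruct (HT c Hc) as [Hn _].
    elim Hn. unfold on in *. now rewrite F3 in H by lia. }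
  destruct (search_spec n px py M M 0 2 env s3 ltac:(lia) Hs3 Hb3) as (_ & _ & S3 & S4).
  fold r in S3, S4.
  set (s4 := sem n (search M 0 2) env s3) in *.
  assert (F4 : forall A, ~ In A [aCUR; aBST; vBEST; vOK; vHIT] -> arr s4 A = arr s3 A).
  { intros A HA. unfold s4. apply sem_frame. now apply search_writes. }
  assert (T4 : forall p, (p < n)%nat ->
     on s4 aTGT p <-> on s aREM p /\ near (INR (2 * S k) * r) v p).
  { intros p Hp. unfold on. rewrite F4 by (simpl; lia). rewrite F3 by lia. rewrite <- P2.
    apply (HT p Hp). }
  assert (Hopt : forall t, (length t <= M)%nat ->
     covers r (member t) (fun p => on s aREM p /\ near (INR (2 * S k) * r) v p) ->
     arr s4 vBEST 0%nat <= INR (length t)).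
  { intros t Ht HC. apply (S4 t Ht). intros p Hp Htp.
    destruct (HC p Hp) as (c & Hc & Hin & Hn).
    - apply T4; [exact Hp|]. unfold on in *. now rewrite F4 by (simpl; lia).
    - exists c. split; [exact Hc|]. split; [now right|exact Hn]. }
  (* Packing provides a cover of at most [M] disks, so a search of depth [M] cannot return with its
     initial value. *)
  assert (HM : arr s4 vBEST 0%nat <= INR M).
  { destruct (packing_ball n px py r lg v
      (fun p => on s aREM p /\ near (INR (2 * S k) * r) v p) Hr) as (t & Ht & HC).
    - intros p Hp [_ Hn]. eapply near_mono; [|exact Hn].
      split; [apply Rmult_le_pos; [apply pos_INR|exact Hr]|].
      apply Rmult_le_compat_r; [exact Hr|]. rewrite mult_INR. simpl (INR 2).
      replace (2 ^ lg) with (INR K) by (unfold K; now rewrite pow_INR).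
      apply Rmult_le_compat_l; [lra|]. apply le_INR. lia.
    - eapply Rle_trans; [exact (Hopt t Ht HC)|]. apply le_INR, Ht. }
  (* Covers longer than [M] are out of reach of the search, but they exceed the value found
     anyway. *)
  assert (Hopt' : forall t,
     covers r (member t) (fun p => on s aREM p /\ near (INR (2 * S k) * r) v p) ->
     arr s4 vBEST 0%nat <= INR (length t)).
  { intros t HC. destruct (le_lt_dec (length t) M) as [Ht|Ht]; [now apply Hopt|].
    eapply Rle_trans; [exact HM|]. apply le_INR. lia. }
  assert (Hbo : best_ok M r s4).
  { apply S3. intros H. rewrite B3, S_INR in H. lra. }
  destruct (Hbo HM) as [Hbound Hcov].
  assert (A4 : arr s4 vPREV = arr s1 vPREV) by (rewrite F4, F3, F2 by (simpl; lia); reflexivity).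
  rewrite !eval_cst, A4.
  (* Consecutive radii differ by the clearance between inner and outer ball. *)
  assert (Erad : INR (2 * S k) * r = INR (2 * k) * r + 2 * r).
  { replace (2 * S k)%nat with (2 * k + 2)%nat by lia. rewrite plus_INR. simpl (INR 2). ring. }
  destruct (Rle_dec _ _) as [Hacc|Hrej].
  - left. destruct (accept_spec env s4) as (AA & AC & AR & AV).
    set (s5 := sem n accept env s4) in *.
    split; [exact AA|].
    exists (INR (2 * k) * r), (arr s4 vBEST 0%nat), (on s4 aBST).
    rewrite <- Erad.
    split; [apply Rmult_le_pos; [apply pos_INR|exact Hr]|].
    split; [|split; [|split; [|split; [exact Hbound|split]]]].
    + intros p Hp. rewrite AR, T4 by exact Hp. unfold on at 1.
      rewrite F4, F3, F2, P2 by (simpl; lia). fold (on s aREM p). tauto.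
    + intros p Hp. rewrite AV by exact Hp. unfold on at 1.
      rewrite F4, F3, F2, P3 by (simpl; lia). fold (on s aCOV p). tauto.
    + rewrite AC, F4, F3, F2, P4 by (simpl; lia). reflexivity.
    + intros p Hp HTp. apply Hcov; [exact Hp|]. now apply T4.
    + intros t HC. specialize (P7 t HC).
      eapply Rle_trans; [exact Hacc|]. apply Rmult_le_compat_l; [apply pos_INR|exact P7].
  - right. set (s5 := Store _ _).
    assert (F5 : forall A, A <> vPREV -> arr s5 A = arr s4 A)
      by (intros A h1; cbn [arr s5]; now rewrite upd_arr_other).
    assert (B5 : arr s5 vPREV 0%nat = arr s4 vBEST 0%nat) by (cbn [arr s5]; now rewrite upd_arr_same).
    split; [|split; [|split; [|split; [|split; [|split]]]]].
    + unfold on. rewrite F5, F4, F3, F2 by (simpl; lia). exact P1.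
    + rewrite F5, F4, F3, F2 by (simpl; lia). exact P2.
    + rewrite F5, F4, F3, F2 by (simpl; lia). exact P3.
    + rewrite F5, F4, F3, F2 by (simpl; lia). exact P4.
    + rewrite B5. apply Rnot_le_lt in Hrej. simpl pow.
      replace (q + 1)%nat with (S q) in * by lia.
      assert (Hq : 0 <= INR q ^ k) by (apply pow_le, pos_INR).
      assert (HSq : 0 <= INR (S q)) by apply pos_INR.
      assert (E1 : INR (S q) * INR (S q) ^ k <= INR (S q) * (INR q ^ k * arr s1 vPREV 0%nat))
        by (apply Rmult_le_compat_l; assumption).
      assert (E2 : INR q ^ k * (INR (S q) * arr s1 vPREV 0%nat)
                   <= INR q ^ k * (INR q * arr s4 vBEST 0%nat))
        by (apply Rmult_le_compat_l; [assumption|lra]).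
      lra.
    + rewrite B5. exact HM.
    + rewrite B5. exact Hopt'.
Qed.

Lemma grow_accepted k env s : on s vACC 0 -> sem n (grow q M k) env s = s.
Proof.
  intros H. unfold grow, If_on, sc. cbn [sem eval idx_val].
  destruct (Rle_dec 1 _) as [_|Hn]; [reflexivity|contradiction].
Qed.

Lemma grows_spec env s s0 : holds_points s0 ->
  let r := INR (env 0%nat) in let v := env 1%nat in
  pending r v 0 s s0 ->
  forall k, (k <= K)%nat ->
  let s' := sem n (grows q M k) env s0 in
  (on s' vACC 0 /\ accepted r v s s') \/ pending r v k s s'.
Proof.
  intros Hs0 r v H0. induction k as [|k IH]; intros Hk; [right; exact H0|].
  cbn [grows sem]. destruct IH as [[HA Hacc]|Hp]; [lia| |].
  - left. rewrite grow_accepted by exact HA. now split.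
  - apply grow_spec; [lia| |exact Hp].
    assert (Hf : forall A, (A < 2)%nat -> arr (sem n (grows q M k) env s0) A = arr s0 A).
    { intros A HA. apply sem_frame. clear - HA.
      induction k as [|k IH]; [reflexivity|]. cbn [grows writes]. rewrite IH.
      unfold grow, If_on. cbn [writes]. rewrite search_writes by (simpl; lia).
      destruct A as [|[|A]]; [reflexivity|reflexivity|lia]. }
    split; rewrite Hf by lia; apply Hs0.
Qed.

Lemma process_spec env s : holds_points s -> (env 1%nat < n)%nat -> on s aREM (env 1%nat) ->
  accepted (INR (env 0%nat)) (env 1%nat) s (sem n (process q M K) env s).
Proof.
  intros Hs Hv Hrem. unfold process. cbn [sem].
  set (s1 := Store (upd_arr (arr s) _ _ _) _). set (s0 := Store (upd_arr (arr s1) _ _ _) _).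
  assert (F : forall A, A <> vPREV -> A <> vACC -> arr s0 A = arr s A)
    by (intros A h1 h2; cbn [arr s0 s1]; now rewrite !upd_arr_other).
  assert (E : arr s0 vPREV 0%nat = 1).
  { cbn [arr s0 s1 idx_val]. rewrite upd_arr_other, upd_arr_same, eval_cst by lia. reflexivity. }
  assert (HM1 : (1 <= M)%nat) by (apply Nat.neq_0_le_1, Nat.pow_nonzero; lia).
  destruct (grows_spec env s s0) with (k := K) as [[_ H]|H].
  - split; rewrite F by lia; apply Hs.
  - split; [|split; [|split; [|split; [|split; [|split]]]]];
      try (rewrite F by lia; reflexivity).
    + unfold on. cbn [arr s0 idx_val]. rewrite upd_arr_same, eval_cst. simpl. lra.
    + rewrite E. simpl. lra.
    + rewrite E. change 1 with (INR 1). now apply le_INR.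
    (* Any cover of the ball of radius 0 has a disk for [v], which is still uncovered, so it is
       nonempty. *)
    + intros t HC. rewrite E. destruct (HC (env 1%nat) Hv) as (c & _ & Hin & _).
      { split; [exact Hrem|apply near_refl]. }
      change 1 with (INR 1). apply le_INR. destruct t; [contradiction|simpl; lia].
  - lia.
  - exact H.
  - exfalso. destruct H as (_ & _ & _ & _ & H1 & H2 & _).
    apply lt_INR in Hgrowth. rewrite mult_INR, !pow_INR in Hgrowth.
    assert (INR q ^ K * arr (sem n (grows q M K) env s0) vPREV 0%nat <= INR q ^ K * INR M)
      by (apply Rmult_le_compat_l; [apply pow_le, pos_INR|exact H2]).
    lra.
Qed.

Lemma process_frame A env s : (A < 2)%nat \/ A = vSUC ->
  arr (sem n (process q M K) env s) A = arr s A.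
Proof.
  intros HA. apply sem_frame. unfold process. cbn [writes].
  assert (Hg : forall k, writes (grows q M k) A = false).
  { induction k as [|k IH]; [reflexivity|]. cbn [grows writes]. rewrite IH.
    unfold grow, If_on. cbn [writes]. rewrite search_writes by (simpl; lia).
    destruct HA as [HA| ->]; [destruct A as [|[|A]]; [reflexivity|reflexivity|lia]|reflexivity]. }
  rewrite Hg. destruct HA as [HA| ->]; [destruct A as [|[|A]]; [reflexivity|reflexivity|lia]|reflexivity].
Qed.

Definition cover_ok (dl : nat) (s : store) : Prop :=
  exists l, INR q * INR (length l) <= INR (S q) * INR (S dl) /\
    (forall c, (c < n)%nat -> on s aCOV c -> In c l) /\
    covers (INR dl) (on s aCOV) (fun _ => True).

Lemma cover_loop_spec env s : holds_points s ->
  let r := INR (env 0%nat) in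
  (forall p, (p < n)%nat -> on s aREM p) -> (forall p, (p < n)%nat -> ~ on s aCOV p) ->
  arr s vCNT 0%nat = 0 ->
  let s' := sem n (For 1 (If_on (el aREM 1) (process q M K) Skip)) env s in
  covers r (on s' aCOV) (fun _ => True) /\
  bounded_by (on s' aCOV) (arr s' vCNT 0%nat) /\
  (forall C, covers r (member C) (fun _ => True) ->
     INR q * arr s' vCNT 0%nat <= INR (S q) * INR (length C)).
Proof.
  (* The last clause of [I] is the lower bound in the making: whatever the cover [C], the disks
     bought so far are paid for by those members of [C] that meet no remaining point. *)
  intros Hs r HR HC HN s'.
  set (I := fun (i : nat) s' => holds_points s' /\
    (forall p, (p < i)%nat -> ~ on s' aREM p) /\
    (forall p, (p < n)%nat -> on s' aREM p \/ exists c, (c < n)%nat /\ on s' aCOV c /\ near r c p) /\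
    bounded_by (on s' aCOV) (arr s' vCNT 0%nat) /\
    (forall C, covers r (member C) (fun _ => True) ->
       INR q * arr s' vCNT 0%nat <= INR (S q) * INR (dead n px py r (on s' aREM) C))).
  assert (HI : I n s').
  { apply for_ind; unfold I; clear I.
    - split; [exact Hs|]. split; [intros; lia|]. split; [intros p Hp; left; now apply HR|].
      split.
      + exists []. split; [rewrite HN; simpl; lra|]. intros c Hc H. now elim (HC c).
      + intros C _. rewrite HN, Rmult_0_r.
        apply Rmult_le_pos; apply pos_INR.
    - intros i s1 Hi _ _ (I0 & I1 & I2 & I3 & I4). unfold If_on. cbn [sem eval el idx_val].
      rewrite updN_same.
      destruct (Rle_dec 1 (arr s1 aREM i)) as [Hon|Hoff].
      2:{ split; [exact I0|]. split; [|auto]. intros p Hp.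
          destruct (Nat.eq_dec p i) as [->|]; [exact Hoff|apply I1; lia]. }
      pose proof (process_spec (updN env 1 i) s1 I0) as HP.
      rewrite updN_same, updN_other in HP by lia. fold r in HP. specialize (HP Hi Hon).
      set (s2 := sem n (process q M K) (updN env 1 i) s1) in *.
      destruct HP as (rad & m & B & Hrad & PR & PC & PN & (lB & HlB & HinB) & Pcov & Popt).
      split; [split; unfold s2; rewrite process_frame by lia; apply I0|].
      split; [|split; [|split]].
      + intros p Hp H. apply PR in H; [|lia]. destruct H as [H Hfar].
        destruct (Nat.eq_dec p i) as [->|]; [apply Hfar, near_refl|apply (I1 p); [lia|exact H]].
      + intros p Hp. destruct (I2 p Hp) as [H|(c & Hc & Hcov & Hn)].
        * destruct (classic (near (rad + 2 * r) i p)) as [Hnear|Hfar].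
          -- right. destruct (Pcov p Hp (conj H Hnear)) as (c & Hc & HB & Hn).
             exists c. split; [exact Hc|]. split; [|exact Hn]. apply PC; [exact Hc|now right].
          -- left. apply PR; [exact Hp|now split].
        * right. exists c. split; [exact Hc|]. split; [|exact Hn]. apply PC; [exact Hc|now left].
      + destruct I3 as (l & Hl & Hin). exists (l ++ lB). split.
        * rewrite length_app, plus_INR, PN. lra.
        * intros c Hc H. apply in_or_app. apply PC in H; [|exact Hc].
          destruct H; [left; now apply Hin|right; now apply HinB].
      + intros C HCov. rewrite PN.
        (* The members of [C] that meet the inner ball cover it and pay for this round; afterwards
           they are dead and pay no more. *)
        destruct (dead_step n px py r rad i (on s1 aREM) (on s2 aREM) C) as (t & Ht & Hd);
          [apply pos_INR|exact Hrad|intros p Hp H; now apply PR|exact HCov|].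
        specialize (Popt t Ht). specialize (I4 C HCov).
        apply le_INR in Hd. rewrite plus_INR in Hd.
        assert (H0 : 0 <= INR (S q)) by apply pos_INR.
        pose proof (Rmult_le_compat_l _ _ _ H0 Hd). lra. }
  destruct HI as (_ & I1 & I2 & I3 & I4). split; [|split; [exact I3|]].
  - intros p Hp _. destruct (I2 p Hp) as [H|H]; [elim (I1 p Hp H)|exact H].
  - intros C HCov. eapply Rle_trans; [exact (I4 C HCov)|].
    apply Rmult_le_compat_l; [apply pos_INR|]. apply le_INR, filter_length_le.
Qed.

(** A rejected guess carries a certificate: the count is at most [1 + 1/q] times the size of any
    cover, so every cover has more than [r + 1] disks. *)
Lemma guess_spec env s : holds_points s -> ~ on s vSUC 0 ->
  let s' := sem n (guess q M K) env s in
  (on s' vSUC 0 /\ cover_ok (env 0%nat) s') \/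
  (~ on s' vSUC 0 /\ forall t, covers (INR (env 0%nat)) (member t) (fun _ => True) ->
     (S (env 0%nat) < length t)%nat).
Proof.
  intros Hs HS s'. unfold s', guess. cbn [sem].
  set (init := Seq (Put aREM (IVar 1) (cst 1)) (Put aCOV (IVar 1) (cst 0))).
  match goal with |- context [loop n ?f s] => change (loop n f s) with (sem n (For 1 init) env s) end.
  assert (Hinit : forall p, (p < n)%nat ->
     on (sem n (For 1 init) env s) aREM p /\ ~ on (sem n (For 1 init) env s) aCOV p).
  { apply (for_ind n 1 init env s (fun i s' => forall p, (p < i)%nat ->
      on s' aREM p /\ ~ on s' aCOV p)); [intros; lia|].
    intros i s1 Hi _ _ IH p Hp. unfold init. cbn [sem idx_val]. rewrite updN_same, !eval_cst.
    unfold on; cbn [arr]. rewrite (upd_arr_other _ aCOV) by lia.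
    destruct (Nat.eq_dec p i) as [->|Hne].
    - rewrite !upd_arr_same. simpl. split; lra.
    - rewrite !upd_arr_index by exact Hne. rewrite upd_arr_other by lia. apply IH. lia. }
  assert (F1 : forall A, A <> aREM -> A <> aCOV -> arr (sem n (For 1 init) env s) A = arr s A).
  { intros A h1 h2. apply sem_frame. cbn.
    destruct (Nat.eqb_spec A 2); [contradiction|].
    destruct (Nat.eqb_spec A 3); [contradiction|]. reflexivity. }
  set (s1 := sem n (For 1 init) env s) in *. clearbody s1.
  set (s2 := Store (upd_arr (arr s1) vCNT _ _) _).
  assert (F2 : forall A, A <> vCNT -> arr s2 A = arr s1 A)
    by (intros A h1; cbn [arr s2]; now rewrite upd_arr_other).
  match goal with |- context [loop n ?f s2] => change (loop n f s2) with
    (sem n (For 1 (If_on (el aREM 1) (process q M K) Skip)) env s2) end.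
  destruct (cover_loop_spec env s2) as (HC & HB & HO).
  - split; rewrite F2, F1 by lia; apply Hs.
  - intros p Hp. unfold on. rewrite F2 by lia. now apply Hinit.
  - intros p Hp. unfold on. rewrite F2 by lia. now apply Hinit.
  - cbn [arr s2 idx_val]. now rewrite upd_arr_same, eval_cst.
  - assert (F3 : arr (sem n (For 1 (If_on (el aREM 1) (process q M K) Skip)) env s2) vSUC
        = arr s vSUC).
    { rewrite <- F1, <- F2 by lia.
      apply (for_ind n 1 _ env s2 (fun _ s' => arr s' vSUC = arr s2 vSUC)); [reflexivity|].
      intros i s3 _ _ _ IH. unfold If_on. cbn [sem]. destruct Rle_dec; [|exact IH].
      rewrite process_frame by lia. exact IH. }
    set (s3 := sem n (For 1 (If_on (el aREM 1) (process q M K) Skip)) env s2) in *.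
    clearbody s3. unfold sc. cbn [eval idx_val]. rewrite !eval_cst.
    replace (INR (env 0%nat) + INR 1) with (INR (S (env 0%nat))) by (rewrite S_INR; simpl; ring).
    destruct (Rle_dec _ _) as [Hacc|Hrej].
    + left. split; [unfold on; cbn [arr]; rewrite upd_arr_same; simpl; lra|].
      destruct HB as (l & Hl & Hin). exists l. split; [|split].
      * eapply Rle_trans; [|exact Hacc]. apply Rmult_le_compat_l; [apply pos_INR|exact Hl].
      * intros c Hc. unfold on; cbn [arr]. rewrite upd_arr_other by lia. now apply Hin.
      * intros p Hp HT. destruct (HC p Hp HT) as (c & Hc & Hcov & Hn). exists c.
        split; [exact Hc|]. split; [|exact Hn]. unfold on; cbn [arr].
        rewrite upd_arr_other by lia. exact Hcov.
    + right. split; [unfold on; rewrite F3; exact HS|].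
      intros t Ht. apply Nat.nle_gt. intros Hle. apply Hrej.
      eapply Rle_trans; [exact (HO t Ht)|].
      apply Rmult_le_compat_l; [apply pos_INR|]. now apply le_INR.
Qed.

Lemma cover_phase_spec env s : (0 < n)%nat -> holds_points s ->
  let s' := sem n (cover_phase q M K) env s in
  exists dl, cover_ok dl s' /\
    forall dl' t, (dl' < dl)%nat -> covers (INR dl') (member t) (fun _ => True) ->
      (S dl' < length t)%nat.
Proof.
  intros Hn Hs s'. unfold s', cover_phase. cbn [sem]. set (s1 := Store _ _).
  match goal with |- context [loop n ?f s1] => change (loop n f s1) with
    (sem n (For 0 (If_on (sc vSUC) Skip (guess q M K))) env s1) end.
  set (none := fun i => forall dl' t, (dl' < i)%nat ->
    covers (INR dl') (member t) (fun _ => True) -> (S dl' < length t)%nat).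
  set (I := fun i s' => holds_points s' /\ ((on s' vSUC 0 /\ exists dl, cover_ok dl s' /\ none dl)
    \/ (~ on s' vSUC 0 /\ none i))).
  assert (HI : I n (sem n (For 0 (If_on (sc vSUC) Skip (guess q M K))) env s1)).
  { apply for_ind; unfold I.
    - split; [split; cbn [arr s1]; rewrite upd_arr_other by lia; apply Hs|].
      right. split; [|intros dl' t H; lia].
      unfold on; cbn [arr s1 idx_val]. rewrite upd_arr_same, eval_cst. simpl. lra.
    - intros i s2 Hi _ _ [HP HI]. unfold If_on, sc. cbn [sem eval idx_val].
      destruct (Rle_dec 1 (arr s2 vSUC 0%nat)) as [Hon|Hoff].
      + split; [exact HP|]. destruct HI as [H|[H _]]; [now left|contradiction].
      + destruct HI as [[H _]|[_ HN]]; [contradiction|].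
        pose proof (guess_spec (updN env 0 i) s2 HP Hoff) as HG.
        rewrite updN_same in HG. cbv zeta in HG.
        split.
        * assert (Hf : forall A, (A < 2)%nat ->
            arr (sem n (guess q M K) (updN env 0 i) s2) A = arr s2 A).
          { intros A HA. unfold guess. cbn [sem].
            set (s3 := Store (upd_arr _ _ _ _) _).
            match goal with |- context [loop n ?f s3] => change (loop n f s3) with
              (sem n (For 1 (If_on (el aREM 1) (process q M K) Skip)) (updN env 0 i) s3) end.
            assert (E3 : arr s3 A = arr s2 A).
            { cbn [arr s3]. rewrite upd_arr_other by lia.
              match goal with |- arr (loop n ?f s2) A = _ => change (loop n f s2) with
                (sem n (For 1 (Seq (Put aREM (IVar 1) (cst 1)) (Put aCOV (IVar 1) (cst 0))))
                   (updN env 0 i) s2) end.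
              apply sem_frame. destruct A as [|[|A]]; [reflexivity|reflexivity|lia]. }
            assert (E4 : arr (sem n (For 1 (If_on (el aREM 1) (process q M K) Skip))
                (updN env 0 i) s3) A = arr s3 A).
            { apply (for_ind n 1 _ _ s3 (fun _ s' => arr s' A = arr s3 A)); [reflexivity|].
              intros j s4 _ _ _ IH. unfold If_on. cbn [sem]. destruct Rle_dec; [|exact IH].
              rewrite process_frame by lia. exact IH. }
            destruct Rle_dec; [cbn [arr]; rewrite upd_arr_other by lia|]; congruence. }
          split; rewrite Hf by lia; apply HP.
        * destruct HG as [[H1 H2]|[H1 H2]].
          -- left. split; [exact H1|]. now exists i.
          -- right. split; [exact H1|]. intros dl' t Hlt Ht.
             destruct (Nat.eq_dec dl' i) as [->|]; [now apply H2|apply HN; [lia|exact Ht]]. }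
  destruct HI as [_ [[_ H]|[_ HN]]]; [exact H|].
  (* The largest guess cannot be rejected: the [n] points cover themselves, and
     [n = (n - 1) + 1]. *)
  exfalso. specialize (HN (n - 1)%nat (seq 0 n) ltac:(lia)).
  rewrite length_seq in HN.
  assert (Hc : covers (INR (n - 1)) (member (seq 0 n)) (fun _ => True)).
  { intros p Hp _. exists p. split; [exact Hp|]. split; [apply in_seq; lia|apply near_refl]. }
  specialize (HN Hc). lia.
Qed.

End Rounds.
End Phase.

Section Burning.

Variable n : nat.
Variables px py : nat -> R.

Notation near := (near px py).
Notation covers := (covers n px py).
Notation holds_points := (holds_points px py).

(** * Greedy burning along a cover *)

Definition burnt (cs : list nat) (i p : nat) : Prop :=
  exists j c, (j < i)%nat /\ nth_error cs j = Some c /\ near (INR (i - j)) c p.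

Definition greedy (V : nat -> Prop) (cs : list nat) : Prop :=
  forall j c, nth_error cs j = Some c ->
    (c < n)%nat /\ ~ burnt cs j c /\
    (V c \/ forall x, (x < n)%nat -> V x -> burnt cs j x).

Lemma burnt_spread cs i d c p : near (INR d) c p -> burnt cs i c -> burnt cs (i + d) p.
Proof.
  intros Hn (j & y & Hj & Hy & Hyc). exists j, y. split; [lia|]. split; [exact Hy|].
  replace (i + d - j)%nat with (i - j + d)%nat by lia. rewrite plus_INR.
  apply (near_trans px py _ _ y c p); [apply pos_INR|apply pos_INR|exact Hyc|exact Hn].
Qed.

Lemma burnt_mono cs i i' p : (i <= i')%nat -> burnt cs i p -> burnt cs i' p.
Proof.
  intros Hi H. replace i' with (i + (i' - i))%nat by lia.
  eapply burnt_spread; [apply near_refl|exact H].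
Qed.

Lemma burnt_app cs cs' i p : (i <= length cs)%nat -> burnt (cs ++ cs') i p <-> burnt cs i p.
Proof.
  intros Hi. split; intros (j & c & Hj & Hc & Hn); exists j, c; (split; [exact Hj|]).
  - rewrite nth_error_app1 in Hc by lia. now split.
  - rewrite nth_error_app1 by lia. now split.
Qed.

Lemma greedy_snoc V cs p : greedy V cs -> (p < n)%nat -> ~ burnt cs (length cs) p ->
  (V p \/ forall x, (x < n)%nat -> V x -> burnt cs (length cs) x) -> greedy V (cs ++ [p]).
Proof.
  intros HG Hp Hb Hv j c Hc.
  destruct (lt_dec j (length cs)) as [Hlt|Hge].
  - rewrite nth_error_app1 in Hc by exact Hlt. destruct (HG j c Hc) as (H1 & H2 & H3).
    split; [exact H1|]. rewrite burnt_app by lia. split; [exact H2|].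
    destruct H3 as [H3|H3]; [now left|right]. intros x Hx HVx. apply burnt_app; [lia|auto].
  - assert (Hj : j = length cs).
    { assert (j < length (cs ++ [p]))%nat by (apply nth_error_Some; congruence).
      rewrite length_app in H. simpl in H. lia. }
    subst j. rewrite nth_error_app2, Nat.sub_diag in Hc by lia. simpl in Hc.
    injection Hc as <-. split; [exact Hp|]. rewrite burnt_app by lia. split; [exact Hb|].
    destruct Hv as [H3|H3]; [now left|right]. intros x Hx HVx. apply burnt_app; [lia|auto].
Qed.

(** Each source taken from [V] is struck off the list of possibly unburnt centres, so [V] is burnt
    after [length l] steps whatever the choices. All points are burnt [dl] steps later, which leaves
    no candidate for position [length l + dl]. *)
Lemma greedy_length V cs l dl : greedy V cs ->
  (forall c, (c < n)%nat -> V c -> In c l) -> covers (INR dl) V (fun _ => True) ->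
  (length cs <= length l + dl)%nat.
Proof.
  intros HG Hl HC.
  assert (Hprog : forall i, (i <= length cs)%nat ->
    (forall x, (x < n)%nat -> V x -> burnt cs i x) \/
    exists l', (length l' + i <= length l)%nat /\
      forall x, (x < n)%nat -> V x -> burnt cs i x \/ In x l').
  { induction i as [|i IH]; intros Hi.
    - right. exists l. split; [lia|]. intros x Hx HV. right. now apply Hl.
    - destruct IH as [H|(l' & Hlen & H)]; [lia| |].
      { left. intros x Hx HV. apply (burnt_mono cs i); [lia|auto]. }
      destruct (nth_error cs i) as [c|] eqn:Ec; [|apply nth_error_None in Ec; lia].
      destruct (HG i c Ec) as (Hc & Hnb & [HVc|Hall]).
      + right. destruct (H c Hc HVc) as [Hb|Hin]; [contradiction|].
        exists (remove Nat.eq_dec c l'). split.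
        * pose proof (remove_length_lt Nat.eq_dec l' c Hin). lia.
        * intros x Hx HV. destruct (Nat.eq_dec x c) as [->|Hne].
          -- left. exists i, c. split; [lia|]. split; [exact Ec|apply near_refl].
          -- destruct (H x Hx HV) as [Hb|Hin'].
             ++ left. apply (burnt_mono cs i); [lia|exact Hb].
             ++ right. now apply in_in_remove.
      + left. intros x Hx HV. apply (burnt_mono cs i); [lia|auto]. }
  apply Nat.nlt_ge. intros Hlt. set (m := length l) in *.
  assert (Hm : forall x, (x < n)%nat -> V x -> burnt cs m x).
  { destruct (Hprog m) as [H|(l' & Hlen & H)]; [lia|exact H|].
    destruct l'; [|simpl in Hlen; lia]. intros x Hx HV. destruct (H x Hx HV) as [Hb|[]]. exact Hb. }
  destruct (nth_error cs (m + dl)) as [p|] eqn:Ep; [|apply nth_error_None in Ep; lia].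
  destruct (HG _ _ Ep) as (Hp & Hnb & _). apply Hnb.
  destruct (HC p Hp I) as (c & Hc & HV & Hn).
  apply (burnt_spread cs m dl c p Hn). now apply Hm.
Qed.

(** * The burning phase *)

Definition sources_ok (cs : list nat) (s : store) : Prop :=
  (forall j c, nth_error cs j = Some c -> on s aSRC c /\ arr s aTIME c = INR j) /\
  (forall c, (c < n)%nat -> on s aSRC c -> In c cs).

Lemma set_burnt_spec cs env s : holds_points s -> sources_ok cs s ->
  (forall c, In c cs -> (c < n)%nat) -> length cs = env 0%nat ->
  forall p, (p < n)%nat -> on (sem n set_burnt env s) aBURN p <-> burnt cs (env 0%nat) p.
Proof.
  intros Hs [S1 S2] Hcs Hlen.
  set (inner := For 2 (If_on (el aSRC 2)
      (IfLe (esqd 2 1) (sq (ESub (EVar 0) (el aTIME 2)))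
        (Put aBURN (IVar 1) (cst 1)) Skip) Skip)).
  set (i0 := env 0%nat) in *.
  set (fire := fun c p => on s aSRC c /\
    sqd px py c p <= (INR i0 - arr s aTIME c) * (INR i0 - arr s aTIME c)).
  assert (Hfire : forall p, (exists c, (c < n)%nat /\ fire c p) <-> burnt cs i0 p).
  { intros p. split.
    - intros (c & Hc & Hon & Hd). destruct (In_nth_error cs c (S2 c Hc Hon)) as [j Hj].
      destruct (S1 j c Hj) as [_ Ht]. assert (Hji : (j < i0)%nat).
      { rewrite <- Hlen. apply nth_error_Some. congruence. }
      exists j, c. split; [exact Hji|]. split; [exact Hj|]. red.
      rewrite minus_INR by lia. now rewrite Ht in Hd.
    - intros (j & c & Hj & Hc & Hn). exists c. destruct (S1 j c Hc) as [Hon Ht].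
      split; [apply Hcs; eapply nth_error_In; exact Hc|]. split; [exact Hon|].
      rewrite Ht. red in Hn. now rewrite minus_INR in Hn by lia. }
  assert (Hin : forall i s1, holds_points s1 -> arr s1 aSRC = arr s aSRC -> arr s1 aTIME = arr s aTIME ->
    let s2 := sem n inner (updN env 1 i) s1 in
    (on s2 aBURN i <-> on s1 aBURN i \/ exists c, (c < n)%nat /\ fire c i) /\
    (forall p, p <> i -> arr s2 aBURN p = arr s1 aBURN p)).
  { intros i s1 Hs1 HS HT s2. unfold s2, inner.
    apply (for_ind n 2 _ (updN env 1 i) s1 (fun k s' =>
      (on s' aBURN i <-> on s1 aBURN i \/ exists c, (c < k)%nat /\ fire c i) /\
      (forall p, p <> i -> arr s' aBURN p = arr s1 aBURN p))).
    { split; [|reflexivity]. split; [tauto|]. intros [H|(c & Hc & _)]; [exact H|lia]. }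
    intros k s3 Hk F _ [IH1 IH2].
    assert (Hs3 : holds_points s3) by (split; rewrite F by reflexivity; apply Hs1).
    assert (HS3 : arr s3 aSRC = arr s aSRC) by (rewrite F by reflexivity; exact HS).
    assert (HT3 : arr s3 aTIME = arr s aTIME) by (rewrite F by reflexivity; exact HT).
    assert (Hmono : ~ fire k i ->
      (on s3 aBURN i <-> on s1 aBURN i \/ exists c, (c < S k)%nat /\ fire c i)).
    { intros Hnf. rewrite IH1. split; (intros [H|(c & Hc & Hf)]; [now left|right; exists c]).
      - split; [lia|exact Hf].
      - split; [|exact Hf]. destruct (Nat.eq_dec c k); [subst; contradiction|lia]. }
    unfold If_on. cbn [sem]. rewrite (eval_esqd px py) by exact Hs3.
    cbn [eval el sq idx_val]. rewrite !updN_same, !eval_cst.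
    rewrite !(updN_other _ 2) by lia. rewrite !updN_same, !(updN_other _ 1) by lia.
    fold i0. rewrite HS3, HT3.
    destruct (Rle_dec 1 (arr s aSRC k)) as [Hon|Hoff].
    2:{ split; [|exact IH2]. apply Hmono. intros [H _]. contradiction. }
    destruct (Rle_dec _ _) as [Hd|Hd].
    2:{ split; [|exact IH2]. apply Hmono. intros [_ H]. contradiction. }
    split.
    - unfold on at 1; cbn [arr]. rewrite upd_arr_same. simpl. split; [|lra].
      intros _. right. exists k. split; [lia|]. now split.
    - intros p Hp. cbn [arr]. rewrite upd_arr_index by exact Hp. now apply IH2. }
  unfold set_burnt. fold inner.
  apply (for_ind n 1 _ env s (fun i s' =>
    forall p, (p < i)%nat -> on s' aBURN p <-> burnt cs i0 p)); [intros; lia|].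
  intros i s1 Hi F _ IH p Hp. cbn [sem idx_val]. rewrite updN_same, eval_cst.
  set (s2 := Store _ _).
  assert (F2 : forall A, A <> aBURN -> arr s2 A = arr s1 A)
    by (intros A h1; cbn [arr s2]; now rewrite upd_arr_other).
  destruct (Hin i s2) as [H1 H2].
  - split; rewrite F2, F by (reflexivity || lia); apply Hs.
  - rewrite F2, F by (reflexivity || lia). reflexivity.
  - rewrite F2, F by (reflexivity || lia). reflexivity.
  - destruct (Nat.eq_dec p i) as [->|Hne].
    + rewrite H1, <- Hfire. split; [|now right]. intros [H|H]; [|exact H].
      unfold on in H; cbn [arr s2] in H. rewrite upd_arr_same in H. simpl in H. lra.
    + unfold on at 1. rewrite H2 by exact Hne. cbn [arr s2].
      rewrite upd_arr_index by exact Hne. apply IH. lia.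
Qed.

Definition picked (env : nat -> nat) (G : nat -> Prop) (s s' : store) : Prop :=
  exists p, (p < n)%nat /\ ~ on s aBURN p /\ G p /\ on s' vFOUND 0 /\
    out s' = Some p :: out s /\
    arr s' aSRC = updR (arr s aSRC) p 1 /\ arr s' aTIME = updR (arr s aTIME) p (INR (env 0%nat)).

Lemma pick_found g env s : on s vFOUND 0 -> sem n (pick g) env s = s.
Proof.
  intros H. unfold pick. apply (for_ind n 1 _ env s (fun _ s' => s' = s)); [reflexivity|].
  intros i s' _ _ _ ->. unfold If_on, sc. cbn [sem]. destruct Rle_dec; [reflexivity|].
  cbn [eval idx_val]. destruct (Rle_dec 1 (arr s vFOUND 0%nat)); [reflexivity|contradiction].
Qed.

Lemma pick_spec g (G : nat -> Prop) env s :
  (forall i, eval (updN env 1 i) (arr s) g >= 1 <-> G i) -> ~ on s vFOUND 0 ->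
  let s' := sem n (pick g) env s in
  picked env G s s' \/ (s' = s /\ forall p, (p < n)%nat -> G p -> on s aBURN p).
Proof.
  intros Hg Hf s'. unfold s', pick.
  apply (for_ind n 1 _ env s (fun i s' => picked env G s s' \/
    (s' = s /\ forall p, (p < i)%nat -> G p -> on s aBURN p))).
  { right. split; [reflexivity|intros; lia]. }
  intros i s1 Hi _ _ IH. unfold If_on, sc. cbn [sem eval el idx_val]. rewrite updN_same.
  destruct IH as [HP|[-> HI]].
  - left. destruct HP as (p & Hp & HB & HG & HF & HO & HS & HT).
    destruct Rle_dec; [|destruct (Rle_dec 1 (arr s1 vFOUND 0%nat)); [|contradiction]];
      exists p; auto 10.
  - destruct (Rle_dec 1 (arr s aBURN i)) as [Hb|Hb].
    { right. split; [reflexivity|]. intros p Hp HG.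
      destruct (Nat.eq_dec p i) as [->|]; [exact Hb|apply HI; [lia|exact HG]]. }
    destruct (Rle_dec 1 (arr s vFOUND 0%nat)) as [H|_]; [contradiction|].
    destruct (Rle_dec 1 (eval (updN env 1 i) (arr s) g)) as [H|H].
    + left. exists i. split; [exact Hi|]. split; [exact Hb|]. split; [apply Hg; lra|].
      unfold select. cbn [sem out arr idx_val eval]. rewrite updN_same, updN_other by lia.
      rewrite !eval_cst. unfold on; cbn [arr].
      split; [|split; [reflexivity|split; reflexivity]].
      rewrite !(upd_arr_other _ aTIME), !(upd_arr_other _ aSRC) by lia.
      rewrite upd_arr_same. simpl. lra.
    + right. split; [reflexivity|]. intros p Hp HG.
      destruct (Nat.eq_dec p i) as [->|]; [elim H; apply Hg in HG; lra|apply HI; [lia|exact HG]].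
Qed.

Definition burning_state (cs : list nat) (s : store) : Prop :=
  ~ on s vDONE 0 /\ out s = rev (map Some cs) /\ sources_ok cs s /\ greedy (on s aCOV) cs.

Definition finished_state (cs : list nat) (s : store) : Prop :=
  on s vDONE 0 /\ out s = None :: rev (map Some cs) /\ greedy (on s aCOV) cs /\
  forall p, (p < n)%nat -> burnt cs (length cs) p.

Lemma burn_step_spec cs env s : holds_points s -> length cs = env 0%nat ->
  burning_state cs s ->
  let s' := sem n burn_step env s in
  (exists p, burning_state (cs ++ [p]) s') \/ finished_state cs s'.
Proof.
  intros Hs Hlen (HD & HO & HSRC & HG) s'.
  assert (Hcs : forall c, In c cs -> (c < n)%nat).
  { intros c Hc. apply In_nth_error in Hc as [j Hj]. apply (HG j c Hj). }
  unfold s', burn_step. cbn [sem].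
  pose proof (set_burnt_spec cs env s Hs HSRC Hcs Hlen) as HB. rewrite <- Hlen in HB.
  set (s1 := sem n set_burnt env s) in *.
  assert (F1 : forall A, A <> aBURN -> arr s1 A = arr s A).
  { intros A h1. unfold s1. apply sem_frame. cbn.
    destruct (Nat.eqb_spec A 9); [contradiction|reflexivity]. }
  assert (O1 : out s1 = out s) by (unfold s1; now apply sem_out).
  clearbody s1. set (s2 := Store _ _).
  assert (F2 : forall A, A <> vFOUND -> arr s2 A = arr s1 A)
    by (intros A h1; cbn [arr s2]; now rewrite upd_arr_other).
  assert (N2 : ~ on s2 vFOUND 0)
    by (unfold on; cbn [arr s2 idx_val]; rewrite upd_arr_same, eval_cst; simpl; lra).
  assert (B2 : forall p, (p < n)%nat -> on s2 aBURN p <-> burnt cs (length cs) p).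
  { intros p Hp. unfold on. rewrite F2 by lia. now apply HB. }
  set (s3 := sem n (pick (el aCOV 1)) env s2). set (s4 := sem n (pick (cst 1)) env s3).
  assert (Hframe : forall A, (A = aCOV \/ A = vDONE) -> arr s4 A = arr s A).
  { intros A HA. unfold s4, s3. rewrite !sem_frame by (destruct HA; subst; reflexivity).
    rewrite F2, F1 by lia. reflexivity. }
  (* Common to both picks, which differ only in why the chosen point respects the greedy order. *)
  assert (Hpick : forall G, picked env G s2 s4 ->
    (forall p, (p < n)%nat -> G p -> on s aCOV p \/
       forall x, (x < n)%nat -> on s aCOV x -> burnt cs (length cs) x) ->
    on s4 vFOUND 0 /\ exists p, burning_state (cs ++ [p]) s4).
  { intros G (p & Hp & Pb & PG & PF & PO & PS & PT) HGp. split; [exact PF|]. exists p.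
    assert (Hnb : ~ burnt cs (length cs) p) by (now rewrite <- B2).
    assert (Hnew : forall j c, nth_error cs j = Some c -> c <> p).
    { intros j c Hj ->. apply Hnb. exists j, p.
      split; [apply nth_error_Some; congruence|]. split; [exact Hj|apply near_refl]. }
    unfold burning_state, on. rewrite !Hframe by auto.
    split; [exact HD|]. split; [|split].
    - rewrite PO. cbn [out s2]. rewrite O1, HO, map_app, rev_app_distr. reflexivity.
    - destruct HSRC as [S1 S2]. split.
      + intros j c Hj. unfold on. rewrite PS, PT, !F2, !F1 by lia. unfold updR.
        destruct (lt_dec j (length cs)) as [Hlt|Hge].
        * rewrite nth_error_app1 in Hj by exact Hlt.
          destruct (Nat.eqb_spec c p) as [->|]; [elim (Hnew j p Hj eq_refl)|now apply S1].
        * assert (Hj' : j = length cs).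
          { assert (j < length (cs ++ [p]))%nat by (apply nth_error_Some; congruence).
            rewrite length_app in H. simpl in H. lia. }
          subst j. rewrite nth_error_app2, Nat.sub_diag in Hj by lia. simpl in Hj.
          injection Hj as <-. rewrite Nat.eqb_refl, Hlen. split; [lra|reflexivity].
      + intros c Hc. unfold on. rewrite PS, F2, F1 by lia. unfold updR.
        intros H. apply in_or_app. destruct (Nat.eqb_spec c p) as [->|]; [right; now left|left].
        now apply S2.
    - apply greedy_snoc; [exact HG|exact Hp|exact Hnb|]. now apply HGp. }
  assert (Hstay : forall c, on s4 vFOUND 0 -> sem n (If_on (sc vFOUND) Skip c) env s4 = s4).
  { intros c H. unfold If_on, sc. cbn [sem eval idx_val].
    destruct Rle_dec; [reflexivity|contradiction]. }
  fold (sem n (If_on (sc vFOUND) Skip (Seq EmitNone (Put vDONE IZero (cst 1)))) env s4).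
  destruct (pick_spec (el aCOV 1) (on s aCOV) env s2) as [Hp|[E3 Hall]].
  { intros i. cbn [eval el idx_val]. rewrite updN_same, F2, F1 by lia. unfold on. lra. }
  { exact N2. }
  - assert (E4 : s4 = s3).
    { unfold s4. apply pick_found. now destruct Hp as (p & _ & _ & _ & H & _). }
    destruct (Hpick (on s aCOV)) as [H1 H2]; [rewrite E4; exact Hp|intros; now left|].
    left. rewrite Hstay by exact H1. exact H2.
  - fold s3 in E3.
    assert (Hall' : forall x, (x < n)%nat -> on s aCOV x -> burnt cs (length cs) x).
    { intros x Hx HV. apply B2; [exact Hx|]. now apply Hall. }
    destruct (pick_spec (cst 1) (fun _ => True) env s2) as [Hp|[E4 Hall2]].
    { intros i. rewrite eval_cst. simpl. split; [auto|lra]. }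
    { exact N2. }
    + destruct (Hpick (fun _ => True)) as [H1 H2];
        [unfold s4; rewrite E3; exact Hp|intros; now right|].
      left. rewrite Hstay by exact H1. exact H2.
    + right. assert (E4' : s4 = s2) by (unfold s4; rewrite E3; exact E4).
      assert (HC4 : arr s4 aCOV = arr s aCOV) by auto.
      unfold If_on, sc. cbn [sem eval idx_val].
      destruct Rle_dec as [H|_]; [elim N2; unfold on; now rewrite <- E4'|].
      split; [unfold on; cbn [arr]; rewrite upd_arr_same; simpl; lra|].
      split; [cbn [out]; rewrite E4'; cbn [out s2]; now rewrite O1, HO|].
      split.
      * unfold on; cbn [arr]. rewrite upd_arr_other, HC4 by lia. exact HG.
      * intros p Hp. apply B2; [exact Hp|]. now apply Hall2.
Qed.

(** A source burns its own place from the next step on, so it cannot be chosen again. *)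
Lemma greedy_NoDup V cs : greedy V cs -> NoDup cs.
Proof.
  intros HG. apply NoDup_nth_error. intros i j Hi E.
  assert (H : forall i j c, nth_error cs i = Some c -> nth_error cs j = Some c -> ~ (i < j)%nat).
  { intros i0 j0 c E1 E2 Hlt. destruct (HG j0 c E2) as (_ & Hb & _). apply Hb.
    exists i0, c. split; [exact Hlt|]. split; [exact E1|apply near_refl]. }
  destruct (nth_error cs i) as [c|] eqn:Ei; [|apply nth_error_None in Ei; lia].
  symmetry in E. pose proof (H i j c Ei E). pose proof (H j i c E Ei). lia.
Qed.

Lemma burn_phase_spec env s : holds_points s -> out s = [] ->
  exists cs, out (sem n burn_phase env s) = None :: rev (map Some cs) /\
    greedy (on s aCOV) cs /\ forall p, (p < n)%nat -> burnt cs (length cs) p.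
Proof.
  intros Hs HO. unfold burn_phase. cbn [sem].
  match goal with |- context [loop n ?f s] =>
    change (loop n f s) with (sem n (For 0 (Put aSRC (IVar 0) (cst 0))) env s) end.
  set (s1 := sem n (For 0 (Put aSRC (IVar 0) (cst 0))) env s).
  assert (F1 : forall A, A <> aSRC -> arr s1 A = arr s A).
  { intros A h1. unfold s1. apply sem_frame. cbn.
    destruct (Nat.eqb_spec A 7); [contradiction|reflexivity]. }
  assert (O1 : out s1 = []) by (unfold s1; rewrite sem_out; [exact HO|reflexivity]).
  assert (S1 : forall p, (p < n)%nat -> ~ on s1 aSRC p).
  { unfold s1. apply (for_ind n 0 _ env s (fun i s' => forall p, (p < i)%nat -> ~ on s' aSRC p));
      [intros; lia|].
    intros i s' Hi _ _ IH p Hp. cbn [sem idx_val]. rewrite updN_same, eval_cst.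
    unfold on; cbn [arr]. destruct (Nat.eq_dec p i) as [->|Hne].
    - rewrite upd_arr_same. simpl. lra.
    - rewrite upd_arr_index by exact Hne. apply IH. lia. }
  clearbody s1. set (s2 := Store _ _).
  assert (F2 : forall A, A <> vDONE -> arr s2 A = arr s1 A)
    by (intros A h1; cbn [arr s2]; now rewrite upd_arr_other).
  match goal with |- context [loop n ?f s2] =>
    change (loop n f s2) with (sem n (For 0 (If_on (sc vDONE) Skip burn_step)) env s2) end.
  set (I := fun i s' => (exists cs, length cs = i /\ burning_state cs s') \/
                        (exists cs, finished_state cs s')).
  assert (HI : I n (sem n (For 0 (If_on (sc vDONE) Skip burn_step)) env s2)).
  { apply for_ind; unfold I.
    - left. exists []. split; [reflexivity|]. split; [|split; [exact O1|split]].
      + unfold on; cbn [arr s2 idx_val]. rewrite upd_arr_same, eval_cst. simpl. lra.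
      + split; [intros [|j] c H; discriminate|]. intros c Hc H. unfold on in H.
        rewrite F2 in H by lia. now elim (S1 c Hc).
      + intros [|j] c H; discriminate.
    - intros i s' Hi F _ IH. unfold If_on, sc. cbn [sem eval idx_val].
      destruct (Rle_dec 1 (arr s' vDONE 0%nat)) as [Hd|Hd].
      + destruct IH as [(cs & _ & H & _)|H]; [contradiction|now right].
      + destruct IH as [(cs & Hlen & H)|(cs & H & _)]; [|contradiction].
        destruct (burn_step_spec cs (updN env 0 i) s') as [[p Hp]|Hp].
        * split; rewrite F, F2, F1 by (reflexivity || lia); apply Hs.
        * now rewrite updN_same.
        * exact H.
        * left. exists (cs ++ [p]). split; [rewrite length_app; simpl; lia|exact Hp].
        * right. now exists cs. }
  assert (HC : arr (sem n (For 0 (If_on (sc vDONE) Skip burn_step)) env s2) aCOV = arr s aCOV)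
    by (rewrite sem_frame, F2, F1 by (reflexivity || lia); reflexivity).
  set (s3 := sem n (For 0 (If_on (sc vDONE) Skip burn_step)) env s2) in *. clearbody s3.
  unfold If_on, sc. cbn [sem eval idx_val].
  destruct HI as [(cs & Hlen & HD & HOut & _ & HG)|(cs & HD & HOut & HG & Hall)]; exists cs.
  - destruct (Rle_dec 1 (arr s3 vDONE 0%nat)) as [H|_]; [contradiction|].
    unfold on in HG. rewrite HC in HG.
    split; [cbn [out]; now rewrite HOut|]. split; [exact HG|].
    intros p Hp.
    (* The loop made a choice in each of its [n] iterations; by the pigeonhole principle the
       distinct sources are all the points. *)
    assert (Hin : In p cs).
    { assert (Hincl : incl (seq 0 n) cs).
      { apply NoDup_length_incl; [exact (greedy_NoDup _ _ HG)|rewrite length_seq; lia|].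
        intros c Hc. apply In_nth_error in Hc as [j Hj]. apply in_seq.
        destruct (HG j c Hj). lia. }
      apply Hincl, in_seq. lia. }
    apply In_nth_error in Hin as [j Hj]. exists j, p.
    split; [apply nth_error_Some; congruence|]. split; [exact Hj|apply near_refl].
  - destruct (Rle_dec 1 (arr s3 vDONE 0%nat)) as [_|H]; [|contradiction].
    unfold on in HG. rewrite HC in HG. now split.
Qed.

End Burning.

(** * The approximation theorem *)

Lemma dist_near P px py i j k :
  px i = fst (nth i P (0, 0)) -> py i = snd (nth i P (0, 0)) ->
  px j = fst (nth j P (0, 0)) -> py j = snd (nth j P (0, 0)) ->
  Defs.dist (nth i P (0, 0)) (nth j P (0, 0)) <= INR k <-> near px py (INR k) i j.
Proof.
  intros E1 E2 E3 E4. unfold Defs.dist, near, sqd. rewrite <- E1, <- E2, <- E3, <- E4.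
  pose proof (pos_INR k) as Hk. split; intros H.
  - set (d := (px i - px j) ^ 2 + (py i - py j) ^ 2) in *.
    assert (Hd : 0 <= d) by (apply Rplus_le_le_0_compat; apply pow2_ge_0).
    pose proof (sqrt_pos d) as H0. pose proof (sqrt_sqrt d Hd) as H1.
    assert (Hle : sqrt d * sqrt d <= INR k * INR k) by (apply Rmult_le_compat; assumption).
    rewrite H1 in Hle. unfold d in Hle. lra.
  - rewrite <- (sqrt_square (INR k)) by exact Hk. apply sqrt_le_1_alt. lra.
Qed.

Lemma decode_nth P cs j c :
  nth j (decode P (map Some cs ++ [None])) None = Some c ->
  exists k, nth_error cs j = Some k /\ c = nth k P (0, 0).
Proof.
  unfold decode. rewrite map_app, map_map. simpl.
  revert j; induction cs as [|k cs IH]; intros [|j]; simpl.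
  - discriminate.
  - destruct j; discriminate.
  - intros H. injection H as <-. now exists k.
  - apply IH.
Qed.

Lemma decode_nth_Some P cs j k : nth_error cs j = Some k ->
  nth j (decode P (map Some cs ++ [None])) None = Some (nth k P (0, 0)).
Proof.
  unfold decode. rewrite map_app, map_map. simpl.
  revert j; induction cs as [|k' cs IH]; intros [|j]; simpl; try discriminate.
  - intros H. now injection H as ->.
  - apply IH.
Qed.

Lemma burning_sequence_of_greedy P px py V cs :
  (forall i, (i < length P)%nat ->
     px i = fst (nth i P (0, 0)) /\ py i = snd (nth i P (0, 0))) ->
  P <> nil -> greedy (length P) px py V cs ->
  (forall p, (p < length P)%nat -> burnt px py cs (length cs) p) ->
  point_burning_seq P (decode P (map Some cs ++ [None])).
Proof.
  intros Hxy HP HG Hall.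
  set (s := decode P (map Some cs ++ [None])).
  (* The final [None] counts as a step, so source [j] ends with radius [length cs - j], exactly the
     one in [burnt cs (length cs)]. *)
  assert (Hlen : length s = (length cs + 1)%nat).
  { unfold s, decode. now rewrite length_map, length_app, length_map. }
  assert (Hdist : forall i j k, (i < length P)%nat -> (j < length P)%nat ->
    Defs.dist (nth i P (0, 0)) (nth j P (0, 0)) <= INR k <-> near px py (INR k) i j).
  { intros i j k Hi Hj. apply dist_near; apply Hxy; assumption. }
  assert (H0 : (0 < length cs)%nat).
  { destruct (Hall 0%nat) as (j & _ & Hj & _); [|lia].
    destruct P; [contradiction|simpl; lia]. }
  split; [lia|]. split; [|split; [|split]].
  - destruct (nth_error cs 0) as [c|] eqn:E; [|apply nth_error_None in E; lia].
    eexists. apply decode_nth_Some. exact E.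
  - intros i Hi. destruct (nth_error cs i) as [c|] eqn:E; [|apply nth_error_None in E; lia].
    unfold s. rewrite (decode_nth_Some P cs i c E). discriminate.
  - intros i c Hc. apply decode_nth in Hc as (k & Hk & ->). destruct (HG i k Hk) as (Hkn & Hnb & _).
    split; [now apply nth_In|]. intros (j & c & Hj & Hc & Hd).
    apply decode_nth in Hc as (k' & Hk' & ->). apply Hnb. exists j, k'.
    split; [exact Hj|]. split; [exact Hk'|].
    apply Hdist; [apply (HG j k' Hk')|exact Hkn|exact Hd].
  - intros p Hp. destruct (In_nth P p (0, 0) Hp) as (x & Hx & <-).
    destruct (Hall x Hx) as (j & c & Hj & Hc & Hn). exists j, (nth c P (0, 0)).
    split; [now apply decode_nth_Some|]. replace (length s - 1 - j)%nat with (length cs - j)%nat by lia.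
    apply Hdist; [apply (HG j c Hc)|exact Hx|exact Hn].
Qed.

(** All disks are enlarged to the radius of the earliest possible source. Number and radius are then
    each bounded by the length of the sequence, and adding the two bounds accounts for the factor
    2. *)
Lemma cover_of_burning_sequence P px py s :
  (forall i, (i < length P)%nat ->
     px i = fst (nth i P (0, 0)) /\ py i = snd (nth i P (0, 0))) ->
  point_burning_seq P s ->
  exists t, (length t <= length s)%nat /\
    covers (length P) px py (INR (length s - 1)) (member t) (fun _ => True).
Proof.
  intros Hxy (_ & _ & _ & Hsrc & Hcov).
  assert (H : forall s' : sched, (forall c, In (Some c) s' -> In c P) ->
    exists t, (length t <= length s')%nat /\
      forall c, In (Some c) s' -> exists k, In k t /\ (k < length P)%nat /\ nth k P (0, 0) = c).
  { induction s' as [|[c|] s' IH]; intros Hin.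
    - exists []. split; [simpl; lia|]. intros c [].
    - destruct IH as (t & Ht & H); [intros c' Hc'; apply Hin; now right|].
      destruct (In_nth P c (0, 0) (Hin c (or_introl eq_refl))) as (k & Hk & E).
      exists (k :: t). split; [simpl; lia|]. intros c' [Hc'|Hc'].
      + injection Hc' as <-. exists k. split; [now left|]. now split.
      + destruct (H c' Hc') as (k' & H1 & H2). exists k'. split; [now right|exact H2].
    - destruct IH as (t & Ht & H); [intros c' Hc'; apply Hin; now right|].
      exists t. split; [simpl; lia|]. intros c' [Hc'|Hc']; [discriminate|auto]. }
  destruct (H s) as (t & Ht & HC).
  { intros c Hc. destruct (In_nth s (Some c) None Hc) as (i & _ & E). now apply (Hsrc i). }
  exists t. split; [exact Ht|]. intros p Hp _.
  destruct (Hcov (nth p P (0, 0)) (nth_In P (0, 0) Hp)) as (j & c & Hj & Hd).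
  assert (Hin : In (Some c) s).
  { rewrite <- Hj. apply nth_In. apply Nat.nle_gt. intros Hle.
    rewrite nth_overflow in Hj by exact Hle. discriminate. }
  destruct (HC c Hin) as (k & Hk & Hkn & <-). exists k. split; [exact Hkn|]. split; [exact Hk|].
  apply (dist_near P px py k p (length s - 1)); try (apply Hxy; assumption).
  eapply Rle_trans; [exact Hd|]. apply le_INR. lia.
Qed.

Theorem theorem1 :
  forall eps : R, 0 < eps ->
  exists (prog : program) (C d : nat),
    forall P : list pt, P <> nil -> NoDup P ->
      exists o : list (option nat),
        halts_within prog (C * length P ^ d + C)%nat (init_config P) o /\
        valid_output P o /\
        point_burning_seq P (decode P o) /\
        forall b : nat, point_burning_number P b ->
          INR (length o) <= (2 + eps) * INR b.
Proof.
  intros eps Heps.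
  destruct (archimed_cor1 eps Heps) as (q & Hq & Hq0).
  destruct (exponential_beats_packing q Hq0) as (lg & Hlg).
  set (M := (4 ^ (lg + 3))%nat) in *. set (K := (2 ^ lg)%nat) in *.
  destruct (compile_correct _ (burning_program_wf q M K)) as (prog & C & d & Hprog).
  exists prog, C, d. intros P HP _.
  destruct (Hprog P) as (s0 & Hxy & Hout & Hhalt). clear Hprog.
  set (n := length P) in *. set (px := arr s0 aX) in *. set (py := arr s0 aY) in *.
  set (env := fun _ : nat => 0%nat) in *.
  assert (Hn : (0 < n)%nat) by (unfold n; destruct P; [contradiction|simpl; lia]).
  unfold burning_program in Hhalt. cbn [sem] in Hhalt.
  destruct (cover_phase_spec n px py q lg Hlg env s0 Hn (conj eq_refl eq_refl))
    as (dl & (l & Hl & Hin & Hcov) & Hmin).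
  fold M K in Hin, Hcov.
  assert (Hfr : forall k, emits (grows q M k) = false /\ writes (grows q M k) aX = false
                          /\ writes (grows q M k) aY = false).
  { induction k as [|k (IH1 & IH2 & IH3)]; [now split|]. cbn [grows emits writes].
    rewrite IH1, IH2, IH3. unfold grow, If_on. cbn [emits writes].
    rewrite search_emits, !search_writes by (simpl; lia). now split. }
  destruct (Hfr K) as (Fe & FX & FY).
  set (s1 := sem n (cover_phase q M K) env s0) in *.
  assert (Hs1 : holds_points px py s1).
  { split; unfold s1; apply sem_frame; unfold cover_phase, guess, process, If_on;
      cbn [writes]; rewrite ?FX, ?FY; reflexivity. }
  assert (Ho1 : out s1 = []).
  { unfold s1. rewrite sem_out; [exact Hout|].
    unfold cover_phase, guess, process, If_on; cbn [emits]; rewrite Fe; reflexivity. }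
  destruct (burn_phase_spec n px py env s1 Hs1 Ho1) as (cs & Hcs & HG & Hall).
  rewrite Hcs in Hhalt. cbn [rev] in Hhalt. rewrite rev_involutive in Hhalt.
  exists (map Some cs ++ [None]). split; [exact Hhalt|]. split; [|split].
  - intros k Hk. apply in_app_or in Hk as [Hk|[Hk|[]]]; [|discriminate].
    apply in_map_iff in Hk as (k' & E & Hk). injection E as ->.
    apply In_nth_error in Hk as [j Hj]. apply (HG j k Hj).
  - now apply (burning_sequence_of_greedy P px py (on s1 aCOV) cs).
  - intros b [(s & Hs & <-) _].
    destruct (cover_of_burning_sequence P px py s Hxy Hs) as (t & Ht & HC).
    assert (Hlen1 : (1 <= length s)%nat) by apply Hs.
    (* Guesses below [dl] admit no cover of size guess plus one, whereas [s] supplies one of size at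
       most [length s] for the guess [length s - 1]. *)
    assert (Hdl : (S dl <= length s)%nat).
    { apply Nat.nlt_ge. intros Hlt. specialize (Hmin (length s - 1)%nat t ltac:(lia) HC). lia. }
    pose proof (greedy_length n px py _ cs l dl HG Hin Hcov) as Hcl.
    rewrite length_app, length_map. cbn [length].
    (* The last step without source is absorbed in [S dl], so no additive constant remains. *)
    assert (H1 : INR (length cs + 1) <= INR (length l) + INR (S dl))
      by (rewrite <- plus_INR; apply le_INR; lia).
    apply le_INR in Hdl. set (b := INR (length s)) in *. set (x := INR (S dl)) in *.
    assert (Hqp : 0 < INR q) by (apply lt_0_INR; lia).
    assert (Hx : 0 <= x) by apply pos_INR.
    rewrite S_INR in Hl.
    assert (H2 : INR (length l) <= x + / INR q * x).
    { apply (Rmult_le_reg_l (INR q)); [exact Hqp|].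
      replace (INR q * (x + / INR q * x)) with ((INR q + 1) * x) by (field; lra). exact Hl. }
    assert (H3 : / INR q * x <= eps * b).
    { apply Rmult_le_compat; [left; now apply Rinv_0_lt_compat|exact Hx|lra|exact Hdl]. }
    lra.
Qed.
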